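(* Let $n \geq 1$ and let $f : S^{n} \to S^{n}$ be an orientation preserving $C^{1}$ diffeomorphism. Given $\epsilon > 0$, there exist $m \in \mathbb{N}$, depending on $f$ (and $\epsilon$), and homeomorphisms $f_{1}, \ldots, f_{m} : S^{n} \to S^{n}$ such that $f = f_{m} \circ \cdots \circ f_{1}$, where, for each $k = 1, \ldots, m$, $f_{k}$ is $(1+\epsilon)$-bi-Lipschitz with respect to the spherical metric $\chi$, and $\chi(f_{k}(x), x) < \epsilon$ for all $x \in S^{n}$.
   Context: $S^{n} = \mathbb{R}^{n} \cup \{\infty\}$ is the sphere of dimension $n$ (with its standard smooth structure, identified via stereographic projection), equipped with the spherical metric $\chi(x,y) = \frac{|x-y|}{\sqrt{1+|x|^{2}}\sqrt{1+|y|^{2}}}$ for $x,y \in \mathbb{R}^{n}$, $\chi(x,\infty) = \frac{1}{\sqrt{1+|x|^{2}}}$ for $x \in \mathbb{R}^n$ (and $\chi(\infty,\infty)=0$). A homeomorphism $g: X \to X$ of a metric space $(X,d_X)$ is $L$-bi-Lipschitz ($L \geq 1$) if $d_X(x,y)/L \leq d_X(g(x),g(y)) \leq L\, d_X(x,y)$ for all $x,y \in X$. *)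

(* Defs.v *)
From HB Require Import structures.
From mathcomp Require Import all_boot all_order all_algebra.
From mathcomp Require Import all_classical all_reals all_analysis.
From mathcomp Require Import ring lra.

Set Implicit Arguments.
Unset Strict Implicit.
Unset Printing Implicit Defensive.

Import Order.TTheory GRing.Theory Num.Theory.
Import numFieldNormedType.Exports.

Local Open Scope classical_set_scope.
Local Open Scope ring_scope.

(* The library norm on 'rV[R]_n is the sup norm; it induces the usual topology
   and differentiability, but chi is defined from the Euclidean norm. *)
Definition sqnorm (R : realType) (n : nat) (x : 'rV[R]_n) : R :=
  \sum_(i < n) x 0 i ^+ 2.

Definition enorm (R : realType) (n : nat) (x : 'rV[R]_n) : R :=
  Num.sqrt (sqnorm x).

(* S^n = R^n together with a point at infinity, represented by None. *)
Definition sphere (R : realType) (n : nat) : Type := option 'rV[R]_n.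

HB.instance Definition _ (R : realType) (n : nat) := Choice.on (sphere R n).

Definition chi (R : realType) (n : nat) (p q : sphere R n) : R :=
  match p, q with
  | Some x, Some y =>
      enorm (x - y) /
        (Num.sqrt (1 + enorm x ^+ 2) * Num.sqrt (1 + enorm y ^+ 2))
  | Some x, None => 1 / Num.sqrt (1 + enorm x ^+ 2)
  | None, Some y => 1 / Num.sqrt (1 + enorm y ^+ 2)
  | None, None => 0
  end.

Section EuclideanNorm.
Context {R : realType}.

Lemma sqnorm_ge0 n (x : 'rV[R]_n) : 0 <= sqnorm x.
Proof. by apply: sumr_ge0 => i _; exact: sqr_ge0. Qed.

Lemma enorm_ge0 n (x : 'rV[R]_n) : 0 <= enorm x.
Proof. exact: sqrtr_ge0. Qed.

Lemma sqr_enorm n (x : 'rV[R]_n) : enorm x ^+ 2 = sqnorm x.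
Proof. by rewrite sqr_sqrtr// sqnorm_ge0. Qed.

Lemma sqnorm_eq0 n (x : 'rV[R]_n) : (sqnorm x == 0) = (x == 0).
Proof.
apply/idP/idP => [/eqP x0|/eqP->]; last first.
  by rewrite /sqnorm big1// => i _; rewrite mxE expr0n.
apply/eqP/rowP => i; rewrite mxE; apply/eqP; rewrite -sqrf_eq0.
apply/eqP/(psumr_eq0P (P := xpredT) (F := fun i => x 0 i ^+ 2)) => //.
by move=> j _; exact: sqr_ge0.
Qed.

Lemma sqnormZ n (a : R) (x : 'rV[R]_n) : sqnorm (a *: x) = a ^+ 2 * sqnorm x.
Proof. by rewrite /sqnorm mulr_sumr; apply: eq_bigr => i _; rewrite mxE exprMn. Qed.

Lemma cauchy_schwarz_sum n (x y : 'rV[R]_n) :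
  (\sum_i x 0 i * y 0 i) ^+ 2 <= sqnorm x * sqnorm y.
Proof.
set s := \sum_i _.
have : 0 <= \sum_i (sqnorm y * x 0 i - s * y 0 i) ^+ 2.
  by apply: sumr_ge0 => i _; exact: sqr_ge0.
have -> : \sum_i (sqnorm y * x 0 i - s * y 0 i) ^+ 2 =
    sqnorm y ^+ 2 * sqnorm x - (sqnorm y * s *+ 2) * s + s ^+ 2 * sqnorm y.
  rewrite (_ : sqnorm y * s *+ 2 * s = sqnorm y * (s * s *+ 2)); last by ring.
  rewrite (_ : sqnorm y ^+ 2 * sqnorm x = \sum_i sqnorm y ^+ 2 * x 0 i ^+ 2).
    rewrite (_ : sqnorm y * (s * s *+ 2) = \sum_i sqnorm y * s *+ 2 * (x 0 i * y 0 i)).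
      rewrite (_ : s ^+ 2 * sqnorm y = \sum_i s ^+ 2 * y 0 i ^+ 2).
        rewrite -sumrN -!big_split/=; apply: eq_bigr => i _; ring.
      by rewrite -mulr_sumr.
    by rewrite -mulr_sumr -/s; ring.
  by rewrite -mulr_sumr.
have [y0|y0] := eqVneq (sqnorm y) 0.
  move=> _; have /eqP yE : y == 0 by rewrite -sqnorm_eq0 y0.
  rewrite y0 mulr0 /s big1 ?expr0n// => i _; by rewrite yE mxE mulr0.
have yp : 0 < sqnorm y by rewrite lt_def y0 sqnorm_ge0.
have -> : sqnorm y ^+ 2 * sqnorm x - sqnorm y * s *+ 2 * s + s ^+ 2 * sqnorm y =
  sqnorm y * (sqnorm x * sqnorm y - s ^+ 2) by ring.
by rewrite pmulr_rge0// subr_ge0.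
Qed.

Lemma sqnormD n (x y : 'rV[R]_n) :
  sqnorm (x + y) = sqnorm x + sqnorm y + (\sum_i x 0 i * y 0 i) *+ 2.
Proof.
rewrite /sqnorm -sumrMnl -!big_split/=.
by apply: eq_bigr => i _; rewrite mxE; ring.
Qed.

Lemma enormD n (x y : 'rV[R]_n) : enorm (x + y) <= enorm x + enorm y.
Proof.
rewrite -(ler_pXn2r (n := 2))// ?nnegrE ?addr_ge0 ?enorm_ge0//.
rewrite sqrrD !sqr_enorm sqnormD [leRHS]addrAC lerD2l lerMn2r/=.
apply: le_trans (ler_norm _) _.
rewrite -(ler_pXn2r (n := 2))// ?nnegrE ?mulr_ge0 ?enorm_ge0//.
by rewrite -normrX ger0_norm ?sqr_ge0// exprMn !sqr_enorm cauchy_schwarz_sum.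
Qed.

Lemma enormN n (x : 'rV[R]_n) : enorm (- x) = enorm x.
Proof.
by congr (Num.sqrt _); apply: eq_bigr => i _; rewrite mxE sqrrN.
Qed.

Lemma enorm_eq0 n (x : 'rV[R]_n) : enorm x = 0 -> x = 0.
Proof.
by move=> x0; apply/eqP; rewrite -sqnorm_eq0 -sqr_enorm x0 expr0n.
Qed.

End EuclideanNorm.

Section ChiMetric.
Context {R : realType} {n : nat}.
Implicit Types p q r : sphere R n.

(* Inverse stereographic projection onto the sphere of radius 1/2 in R^(n+1)
   passing through 0, with infinity sent to 0; chi is the chordal distance
   between the images. *)
Let embed p : 'rV[R]_(n + 1) :=
  if p is Some x then (1 + sqnorm x)^-1 *: row_mx x (const_mx 1) else 0.

Let sqnorm_row_mx (x : 'rV[R]_n) (a : R) :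
  sqnorm (row_mx x (const_mx a : 'rV_1)) = sqnorm x + a ^+ 2.
Proof.
rewrite /sqnorm big_split_ord/= big_ord1 row_mxEr mxE; congr (_ + _).
by apply: eq_bigr => i _; rewrite row_mxEl.
Qed.

Let sq1_gt0 (x : 'rV[R]_n) : 0 < 1 + sqnorm x.
Proof. by rewrite ltr_pwDl// sqnorm_ge0. Qed.

Let sqnorm_embed (x : 'rV[R]_n) : sqnorm (embed (Some x)) = (1 + sqnorm x)^-1.
Proof.
rewrite sqnormZ sqnorm_row_mx expr1n.
by field; rewrite gt_eqF.
Qed.

Let dot_embed (x y : 'rV[R]_n) :
  \sum_i embed (Some x) 0 i * (- embed (Some y)) 0 i =
  - ((1 + sqnorm x)^-1 * (1 + sqnorm y)^-1 * (\sum_i x 0 i * y 0 i + 1)).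
Proof.
have N i : (- embed (Some y)) 0 i = - embed (Some y) 0 i by rewrite mxE.
have E (z : 'rV[R]_n) i : embed (Some z) 0 i =
  (1 + sqnorm z)^-1 * row_mx z (const_mx 1 : 'rV_1) 0 i by rewrite mxE.
rewrite big_split_ord/= big_ord1 N !E !row_mxEr !mxE mulrDr opprD.
congr (_ + _); last by ring.
rewrite mulr_sumr -sumrN; apply: eq_bigr => i _.
by rewrite N !E !row_mxEl; ring.
Qed.

Let chiE p q : chi p q = enorm (embed p - embed q).
Proof.
have sqrt1 (x : 'rV[R]_n) : 1 / Num.sqrt (1 + enorm x ^+ 2) = enorm (embed (Some x)).
  by rewrite /enorm sqnorm_embed sqr_sqrtr ?sqnorm_ge0// sqrtrV ?ltW// div1r.
have sqnormN m (x : 'rV[R]_m) : sqnorm (- x) = sqnorm x.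
  by rewrite -!sqr_enorm enormN.
case: p q => [x|] [y|]; last 3 first.
- by rewrite [embed None]/= subr0 -sqrt1.
- by rewrite [embed None]/= sub0r enormN -sqrt1.
- by rewrite /= subrr /enorm (_ : sqnorm _ = 0) ?sqrtr0//; apply/eqP; rewrite sqnorm_eq0.
rewrite /chi !sqr_enorm -sqrtrM ?ltW// /enorm -sqrtrV; last first.
  by rewrite ltW// mulr_gt0.
rewrite -sqrtrM ?sqnorm_ge0//; congr (Num.sqrt _).
rewrite sqnormD [in RHS]sqnormD !sqnormN !sqnorm_embed dot_embed.
have -> : \sum_i x 0 i * (- y) 0 i = - \sum_i x 0 i * y 0 i.
  by rewrite -sumrN; apply: eq_bigr => i _; rewrite mxE mulrN.
by field; rewrite !gt_eqF.
Qed.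

Lemma chixx p : chi p p = 0.
Proof.
by rewrite chiE subrr; apply/eqP; rewrite sqrtr_eq0 le_eqVlt sqnorm_eq0 eqxx.
Qed.

Lemma chi_eq0 p q : chi p q = 0 -> p = q.
Proof.
have inv_neq0 (x : 'rV[R]_n) : 1 / Num.sqrt (1 + enorm x ^+ 2) != 0.
  by rewrite mulf_neq0 ?oner_eq0// invr_neq0// sqrtr_eq0 -ltNge sqr_enorm.
case: p q => [x|] [y|]//=; last 2 first.
- by move/eqP; rewrite (negbTE (inv_neq0 _)).
- by move/eqP; rewrite (negbTE (inv_neq0 _)).
have d0 (z : 'rV[R]_n) : (Num.sqrt (1 + enorm z ^+ 2) == 0) = false.
  by rewrite sqrtr_eq0 leNgt sqr_enorm sq1_gt0.
move/eqP; rewrite mulf_eq0 invr_eq0 mulf_eq0 !d0 !orbF.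
by move=> /eqP /enorm_eq0 /subr0_eq ->.
Qed.

Lemma chi_sym p q : chi p q = chi q p.
Proof. by rewrite !chiE -enormN opprB. Qed.

Lemma chi_triangle q p r : chi p r <= chi p q + chi q r.
Proof.
rewrite !chiE (_ : embed p - embed r = (embed p - embed q) + (embed q - embed r)).
  exact: enormD.
by rewrite addrA subrK.
Qed.

End ChiMetric.

HB.instance Definition _ (R : realType) (n : nat) :=
  isMetric.Build R (sphere R n) (@chixx R n) (@chi_eq0 R n) (@chi_sym R n)
    (@chi_triangle R n).

(* The inversion x |-> x / |x|^2 reverses orientation; composing it with the
   reflection of the first coordinate makes the two charts below an oriented
   atlas. *)
Definition reflect0 (R : realType) (n : nat) (x : 'rV[R]_n) : 'rV[R]_n :=
  \row_i (if i == 0%N :> nat then - x 0 i else x 0 i).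

Definition rinversion (R : realType) (n : nat) (x : 'rV[R]_n) : 'rV[R]_n :=
  (enorm x ^+ 2)^-1 *: reflect0 x.

(* The charts are the stereographic projections from infinity (b = true) and,
   up to the reflection, from 0 (b = false).  Each is given a junk value at its
   pole, where it is not defined. *)
Definition pole (R : realType) (n : nat) (b : bool) : sphere R n :=
  if b then None else Some 0.

Definition chart_dom (R : realType) (n : nat) (b : bool) : set (sphere R n) :=
  [set p | p <> pole R n b].

Definition chart (R : realType) (n : nat) (b : bool) (p : sphere R n) :
    'rV[R]_n :=
  if p is Some x then (if b then x else rinversion x) else 0.

Definition chart_inv (R : realType) (n : nat) (b : bool) (u : 'rV[R]_n) :
    sphere R n :=
  if b then Some u else if u == 0 then None else Some (rinversion u).

Section ChartTheory.
Context {R : realType} {n : nat}.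

Lemma reflect0K : involutive (@reflect0 R n).
Proof. by move=> x; apply/rowP => i; rewrite !mxE; case: (_ == _); rewrite ?opprK. Qed.

Lemma sqnorm_reflect0 (x : 'rV[R]_n) : sqnorm (reflect0 x) = sqnorm x.
Proof. by apply: eq_bigr => i _; rewrite mxE; case: ifP; rewrite ?sqrrN. Qed.

Lemma rinversionK (x : 'rV[R]_n) : x != 0 -> rinversion (rinversion x) = x.
Proof.
move=> x0; have sx0 : sqnorm x != 0 by rewrite sqnorm_eq0.
rewrite /rinversion !sqr_enorm sqnormZ sqnorm_reflect0.
have -> : reflect0 ((sqnorm x)^-1 *: reflect0 x) = (sqnorm x)^-1 *: x.
  apply/rowP => i.
  by rewrite !mxE; case: (_ == _); rewrite ?mulrN ?opprK.
rewrite scalerA [X in X *: _](_ : _ = 1) ?scale1r//.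
by field.
Qed.

Lemma rinversion_neq0 (x : 'rV[R]_n) : x != 0 -> rinversion x != 0.
Proof.
move=> x0; rewrite -sqnorm_eq0 /rinversion sqnormZ sqnorm_reflect0 sqr_enorm.
by rewrite mulf_neq0// ?expf_neq0 ?invr_neq0// sqnorm_eq0.
Qed.

Lemma chart_inv_dom b (u : 'rV[R]_n) : chart_dom b (chart_inv b u).
Proof.
case: b => //=; rewrite /chart_dom/= /chart_inv; case: eqP => // /eqP u0 [].
by apply/eqP; exact: rinversion_neq0.
Qed.

Lemma chart_invK b (u : 'rV[R]_n) : chart b (chart_inv b u) = u.
Proof.
by case: b => //=; rewrite /chart_inv; case: eqP => [->//|/eqP/rinversionK].
Qed.

Lemma chartK b (p : sphere R n) : chart_dom b p -> chart_inv b (chart b p) = p.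
Proof.
rewrite /chart_dom /chart_inv; case: b p => [] [x|]//= xp; last by rewrite eqxx.
have x0 : x != 0 by apply/eqP => x0; apply: xp; rewrite x0.
by rewrite (negbTE (rinversion_neq0 x0)) rinversionK.
Qed.

End ChartTheory.

Definition C1_at (R : realType) (n : nat) (g : 'rV[R]_n -> 'rV[R]_n)
    (u : 'rV[R]_n) : Prop :=
  (\forall v \near u, differentiable g v) /\
  {for u, continuous (fun v => 'J g v)}.

Definition local_rep (R : realType) (n : nat) (f : sphere R n -> sphere R n)
    (i j : bool) : 'rV[R]_n -> 'rV[R]_n :=
  fun u => chart j (f (chart_inv i u)).

(* As f is continuous, local_rep f i j is free of junk values near every u
   satisfying the domain condition. *)
Definition C1_map (R : realType) (n : nat) (f : sphere R n -> sphere R n) :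
    Prop :=
  continuous f /\
  forall (i j : bool) (u : 'rV[R]_n),
    chart_dom j (f (chart_inv i u)) -> C1_at (local_rep f i j) u.

Definition C1_diffeomorphism (R : realType) (n : nat)
    (f : sphere R n -> sphere R n) : Prop :=
  C1_map f /\
  exists g : sphere R n -> sphere R n,
    [/\ cancel f g, cancel g f & C1_map g].

Definition orientation_preserving (R : realType) (n : nat)
    (f : sphere R n -> sphere R n) : Prop :=
  forall (i j : bool) (u : 'rV[R]_n),
    chart_dom j (f (chart_inv i u)) -> 0 < \det ('J (local_rep f i j) u).

Definition homeomorphism (T : topologicalType) (f : T -> T) : Prop :=
  continuous f /\
  exists g : T -> T, [/\ cancel f g, cancel g f & continuous g].

Definition bi_lipschitz (R : realType) (X : metricType R) (L : R)
    (g : X -> X) : Prop :=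
  forall x y : X, mdist x y / L <= mdist (g x) (g y) <= L * mdist x y.

(* composite g = g_(m-1) \o ... \o g_0. *)
Definition composite (T : Type) (m : nat) (g : 'I_m -> T -> T) : T -> T :=
  \big[(fun a b : T -> T => a \o b)/id]_(k < m) g (rev_ord k).

(* Main.v *)
(* If h - id is d-Lipschitz on R^n and |h(0)| <= d for a small d, then h, extended
   by oo |-> oo, is (1 + eps)-bi-Lipschitz and eps-close to id for chi.  Let G be
   the group generated by the maps allowed in the theorem; it contains the
   translations, the dilations and the rotation iota exchanging 0 and oo, and
   iota permutes the generators by conjugation.

   Composing f with iota, assume f(0) <> oo.  Since GL_n^+ is generated by matrices
   near the identity, the germ of f at 0 is a composition of a translation, near
   identity linear maps and a map tangent to the identity; cutting these off
   gives a compactly supported C^1 map H in G equal to f near 0.  Then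
   q = iota f^-1 H iota is the identity near oo, hence C^1 and compactly
   supported on R^n, and up to a translation it is the identity near 0 as well.

   Such a q lies in G although it need not be isotopic to id through
   diffeomorphisms.  If q is supported in {1 <= |x| < L}, let F be the composition
   over k >= 0 of the conjugates of q by D^k, where D x = L x; these have disjoint
   supports accumulating at 0, F is bi-Lipschitz, and q = F D^-1 F^-1 D.  If s is
   close to 1 and s^N = L then F (s .) F^-1 is near the identity, by the
   self-similarity of F and the uniform continuity of Dq, and its N-th power is
   F D F^-1. *)

From HB Require Import structures.
Require Import Defs.
From mathcomp Require Import all_boot all_order all_algebra.
From mathcomp Require Import all_classical all_reals all_analysis.
From mathcomp Require Import ring lra.

Set Implicit Arguments.
Unset Strict Implicit.
Unset Printing Implicit Defensive.

Import Order.TTheory GRing.Theory Num.Theory.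
Import numFieldNormedType.Exports.

Local Open Scope classical_set_scope.
Local Open Scope ring_scope.

(** * Strict differentiability *)

Section StrictDifferentiability.
Context {R : realType}.

Definition bounded_linear (U V : normedModType R) (D : U -> V) : Prop :=
  (forall a x y, D (a *: x + y) = a *: D x + D y) /\
  exists2 C : R, 0 < C & forall v, `|D v| <= C * `|v|.

(* A map is C^1 exactly when it is strictly differentiable at every point; this
   form composes, and gives Lipschitz bounds, without any mention of Jacobians. *)
Definition strict_derivative (U V : normedModType R) (u : U -> V) (x : U)
    (D : U -> V) : Prop :=
  forall e : R, 0 < e ->
    \forall y \near x & z \near x, `|u y - u z - D (y - z)| <= e * `|y - z|.

Definition sdiff (U V : normedModType R) (u : U -> V) (x : U) : Prop :=
  exists2 D : U -> V, bounded_linear D & strict_derivative u x D.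

(** Inverse maps are tracked only through this weaker property, which is all that
    [generated_annulus] asks of [q']. *)
Definition loclip (U V : normedModType R) (u : U -> V) (x : U) : Prop :=
  exists2 C : R, 0 < C &
    \forall y \near x & z \near x, `|u y - u z| <= C * `|y - z|.

Definition lip (U V : normedModType R) (C : R) (u : U -> V) : Prop :=
  forall y z, `|u y - u z| <= C * `|y - z|.

Section Linear.
Context {U V : normedModType R} (D : U -> V).
Hypothesis bD : bounded_linear D.

Lemma bounded_linear0 : D 0 = 0.
Proof.
by have := bD.1 (-1) 0 0; rewrite scaler0 addr0 scaleN1r addNr.
Qed.

Lemma bounded_linearD x y : D (x + y) = D x + D y.
Proof. by have := bD.1 1 x y; rewrite !scale1r. Qed.

Lemma bounded_linearZ a x : D (a *: x) = a *: D x.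
Proof. by have := bD.1 a x 0; rewrite !addr0 bounded_linear0 addr0. Qed.

Lemma bounded_linearB x y : D (x - y) = D x - D y.
Proof. by rewrite -scaleN1r bounded_linearD bounded_linearZ scaleN1r. Qed.

End Linear.

Lemma near_pair_diag (T : topologicalType) (x : T) (P : T -> T -> Prop) :
  (\forall y \near x & z \near x, P y z) -> \forall y \near x, P y x.
Proof.
move=> [[A B] /= [Ax Bx] AB]; apply: filterS Ax => y Ay.
by apply: (AB (y, x)); split => //=; exact: nbhs_singleton.
Qed.

Lemma near_pair_and (T : topologicalType) (x : T) (P : T -> Prop) :
  (\forall y \near x, P y) -> \forall y \near x & z \near x, P y /\ P z.
Proof. by move=> Px; exists (P, P) => // -[y z] []. Qed.

Lemma near_pair_comp (T S : topologicalType) (g : T -> S) x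
    (P : S -> S -> Prop) : {for x, continuous g} ->
  (\forall y \near g x & z \near g x, P y z) ->
  \forall y \near x & z \near x, P (g y) (g z).
Proof.
move=> gx [[A B] /= [Ax Bx] AB]; exists (g @^-1` A, g @^-1` B).
  by split; exact: gx.
by move=> [y z] [/= Ay Bz]; exact: (AB (g y, g z)).
Qed.

Lemma near_pairS2 (T : topologicalType) (x : T) (P Q S : T -> T -> Prop) :
  (forall y z, P y z -> Q y z -> S y z) ->
  (\forall y \near x & z \near x, P y z) ->
  (\forall y \near x & z \near x, Q y z) ->
  \forall y \near x & z \near x, S y z.
Proof.
move=> PQS nP nQ.
by apply: (@filterS2 _ (nbhs (x, x)) _ _ _ _ _ nP nQ) => -[y z]; exact: PQS.
Qed.

Lemma near_pairS (T : topologicalType) (x : T) (P S : T -> T -> Prop) :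
  (forall y z, P y z -> S y z) ->
  (\forall y \near x & z \near x, P y z) ->
  \forall y \near x & z \near x, S y z.
Proof. by move=> PS nP; apply: (near_pairS2 _ nP nP) => y z + _; exact: PS. Qed.

Lemma near_pairI (T : topologicalType) (x : T) (P Q : T -> T -> Prop) :
  (\forall y \near x & z \near x, P y z) ->
  (\forall y \near x & z \near x, Q y z) ->
  \forall y \near x & z \near x, P y z /\ Q y z.
Proof. exact: near_pairS2. Qed.

Lemma near_pairW (T : topologicalType) (x : T) (P : T -> T -> Prop) :
  (forall y z, P y z) -> \forall y \near x & z \near x, P y z.
Proof. by move=> aP; apply: (@filterE _ (nbhs (x, x))) => -[y z]; exact: aP. Qed.

Lemma near_norm (U : normedModType R) (x : U) (d : R) : 0 < d ->
  \forall y \near x, `|y - x| < d.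
Proof.
by move=> d0; apply/nbhs_normP; exists d => //= y; rewrite /ball_/= distrC.
Qed.

Lemma nearP_norm (U : normedModType R) (x : U) (P : U -> Prop) :
  (\forall y \near x, P y) <-> exists2 d : R, 0 < d & forall y, `|y - x| < d -> P y.
Proof.
split=> [/nbhs_normP[d d0 dP]|[d d0 dP]].
  by exists d => // y yx; apply: dP; rewrite /ball_/= distrC.
by apply: filterS (near_norm x d0).
Qed.

Section Basics.
Context {U V W : normedModType R}.

Lemma sdiff_loclip (u : U -> V) x : sdiff u x -> loclip u x.
Proof.
move=> [D bD /(_ 1 ltr01) h]; have [C C0 hC] := bD.2.
exists (1 + C); first by rewrite addr_gt0.
apply: near_pairS h => y z h.
rewrite -[u y - u z](subrK (D (y - z))) (le_trans (ler_normD _ _))//.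
by rewrite mulrDl lerD.
Qed.

Lemma loclip_continuous (u : U -> V) x : loclip u x -> {for x, continuous u}.
Proof.
move=> [C C0 /near_pair_diag h]; apply/cvgrPdist_lt => e e0.
near=> y; rewrite distrC.
apply: (@le_lt_trans _ _ (C * `|y - x|)); first by near: y.
rewrite -ltr_pdivlMl//; near: y.
by apply: near_norm; rewrite mulr_gt0 ?invr_gt0.
Unshelve. all: by end_near. Qed.

Lemma sdiff_continuous (u : U -> V) x : sdiff u x -> {for x, continuous u}.
Proof. by move/sdiff_loclip/loclip_continuous. Qed.

Lemma lip_loclip C (u : U -> V) x : 0 < C -> lip C u -> loclip u x.
Proof. by move=> C0 uC; exists C => //; exact: near_pairW. Qed.

Lemma near_eq_pair (u v : U -> V) (x : U) : (\forall y \near x, u y = v y) ->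
  \forall y \near x & z \near x, u y = v y /\ u z = v z.
Proof. by move=> h; exact: (near_pair_and h). Qed.

Lemma sdiff_near (u v : U -> V) (x : U) :
  (\forall y \near x, u y = v y) -> sdiff v x -> sdiff u x.
Proof.
move=> uv [D bD h]; exists D => // e /h he.
by apply: near_pairS2 (near_eq_pair uv) he => y z [-> ->].
Qed.

Lemma loclip_near (u v : U -> V) (x : U) :
  (\forall y \near x, u y = v y) -> loclip v x -> loclip u x.
Proof.
move=> uv [C C0 h]; exists C => //.
by apply: near_pairS2 (near_eq_pair uv) h => y z [-> ->].
Qed.

Lemma loclip_comp (u : V -> W) (g : U -> V) x :
  loclip u (g x) -> loclip g x -> loclip (u \o g) x.
Proof.
move=> [C C0 hu] [C' C'0 hg]; exists (C * C'); first exact: mulr_gt0.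
have /near_pair_comp/(_ hu) : {for x, continuous g}.
  by apply: loclip_continuous; exists C'.
move: hg; apply: near_pairS2 => y z h1 h2; apply: le_trans h2 _.
by rewrite -mulrA ler_pM2l.
Qed.

(** The chain rule: the error is the error of [u] on the increment of [g], plus [Du] applied to the
    error of [g]. *)
Lemma sdiff_comp (u : V -> W) (g : U -> V) x :
  sdiff u (g x) -> sdiff g x -> sdiff (u \o g) x.
Proof.
move=> [Du bu hu] sg; have cg := sdiff_continuous sg.
case: sg => [Dg bg hg]; have [Cu Cu0 hCu] := bu.2; have [Cg Cg0 hCg] := bg.2.
exists (Du \o Dg).
  split=> [a y z|]; first by rewrite /= bg.1 bu.1.
  exists (Cu * Cg) => [|v]; first exact: mulr_gt0.
  by rewrite -mulrA (le_trans (hCu _))// ler_pM2l.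
(* [e1] absorbs the local Lipschitz constant [Cg + 1] of [g], which is available because [eg <= 1];
   the other bound on [eg] absorbs the norm of [Du]. Each error then costs [e / 2]. *)
move=> e e0; pose e1 := e / (2 * (Cg + 1)); pose eg := Num.min 1 (e / (2 * Cu)).
have e10 : 0 < e1 by rewrite divr_gt0// mulr_gt0// addr_gt0.
have eg0 : 0 < eg by rewrite lt_min ltr01 divr_gt0// mulr_gt0.
have h1 := near_pair_comp cg (hu _ e10); have h2 := hg _ eg0.
move: h1 h2; apply: near_pairS2 => y z; set d := g y - g z => h1 h2.
have dB : `|d| <= (Cg + 1) * `|y - z|.
  rewrite -[d](subrK (Dg (y - z))) (le_trans (ler_normD _ _))// addrC mulrDl.
  rewrite lerD// (le_trans h2)// ler_wpM2r//.
  by rewrite /eg ge_min lexx.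
rewrite -[u _ - _](subrK (Du d)) -addrA -(bounded_linearB bu).
rewrite (le_trans (ler_normD _ _))//.
have : `|u (g y) - u (g z) - Du d| <= e / 2 * `|y - z|.
  apply: le_trans h1 _; apply: (@le_trans _ _ (e1 * ((Cg + 1) * `|y - z|))).
    by rewrite ler_pM2l.
  rewrite mulrA le_eqVlt; apply/orP; left; apply/eqP; congr (_ * _).
  by rewrite /e1; field; rewrite gt_eqF// addr_gt0.
have : `|Du (d - Dg (y - z))| <= e / 2 * `|y - z|.
  apply: le_trans (hCu _) _.
  apply: (@le_trans _ _ (Cu * (eg * `|y - z|))); first by rewrite ler_pM2l.
  rewrite mulrA ler_wpM2r//.
  apply: (@le_trans _ _ (Cu * (e / (2 * Cu)))).
    by rewrite ler_pM2l// /eg ge_min lexx orbT.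
  by rewrite le_eqVlt; apply/orP; left; apply/eqP; field; rewrite gt_eqF.
lra.
Qed.

Lemma sdiff_bounded_linear (u : U -> V) x : bounded_linear u -> sdiff u x.
Proof.
move=> bu; exists u => // e e0; apply: near_pairW => y z.
by rewrite (bounded_linearB bu) subrr normr0 mulr_ge0// ltW.
Qed.

Lemma sdiff_cst (c : V) (x : U) : sdiff (fun=> c) x.
Proof.
exists (fun=> 0).
  split=> [*|]; first by rewrite scaler0 addr0.
  by exists 1 => // v; rewrite normr0 mulr_ge0.
by move=> e e0; apply: near_pairW => y z; rewrite !subrr normr0 mulr_ge0// ltW.
Qed.

Lemma sdiffD (u v : U -> V) x :
  sdiff u x -> sdiff v x -> sdiff (fun y => u y + v y) x.
Proof.
move=> [Du bu hu] [Dv bv hv]; have [Cu Cu0 hCu] := bu.2; have [Cv Cv0 hCv] := bv.2.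
exists (fun y => Du y + Dv y).
  split=> [a y z|]; first by rewrite bu.1 bv.1 scalerDr addrACA.
  exists (Cu + Cv) => [|w]; first exact: addr_gt0.
  by rewrite (le_trans (ler_normD _ _))// mulrDl lerD.
move=> e e0; have e20 : 0 < e / 2 by rewrite divr_gt0.
move: (hu _ e20) (hv _ e20); apply: near_pairS2 => y z h1 h2.
rewrite (_ : _ - _ - _ = (u y - u z - Du (y - z)) + (v y - v z - Dv (y - z))).
  by rewrite (le_trans (ler_normD _ _))// (splitr e) mulrDl lerD.
by rewrite !opprD !addrA [LHS](AC 6 (1*3*5*2*4*6)).
Qed.

End Basics.

Lemma sdiff_id (U : normedModType R) (x : U) : sdiff id x.
Proof.
apply: sdiff_bounded_linear; split=> //.
by exists 1 => // v; rewrite mul1r.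
Qed.

Lemma sdiff_opp (U : normedModType R) (x : U) : sdiff (fun y : U => - y) x.
Proof.
apply: sdiff_bounded_linear; split=> [a y z|]; first by rewrite opprD scalerN.
by exists 1 => // v; rewrite normrN mul1r.
Qed.

Lemma sdiffZ (U V : normedModType R) (p : U -> R) (v : U -> V) x :
  sdiff (V := R^o) p x -> sdiff v x -> sdiff (fun y => p y *: v y) x.
Proof.
move=> sp sv; have cv := sdiff_continuous sv.
have [L L0 lp] := sdiff_loclip sp.
case: sp => [Dp bp hp]; case: sv => [Dv bv hv].
have [Cp Cp0 hCp] := bp.2; have [Cv Cv0 hCv] := bv.2.
exists (fun y => p x *: Dv y + Dp y *: v x).
  split=> [a y z|].
    rewrite bp.1 bv.1 scalerDr scalerDl !scalerA scalerDr !scalerA (mulrC a).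
    by rewrite addrACA.
  exists (`|p x| * Cv + Cp * (`|v x| + 1)) => [|w].
    by rewrite ltr_wpDl ?mulr_gt0 ?ltr_wpDl// mulr_ge0// ltW.
  rewrite (le_trans (ler_normD _ _))// !normrZ mulrDl lerD//.
    by rewrite -mulrA ler_wpM2l.
  rewrite mulrAC ler_pM//; rewrite lerDl//.
have cp : {for x, continuous (p : U -> R^o)} by apply: loclip_continuous; exists L.
move=> e e0.
have e1 : 0 < e / (4 * (`|p x| + 1)) by rewrite divr_gt0// mulr_gt0// ltr_wpDl.
have e2 : 0 < e / (4 * (`|v x| + 1)) by rewrite divr_gt0// mulr_gt0// ltr_wpDl.
have e3 : 0 < e / (4 * L) by rewrite divr_gt0// mulr_gt0.
have e4 : 0 < e / (4 * Cv) by rewrite divr_gt0// mulr_gt0.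
have e5 : 0 < 1 :> R by [].
have n3 : \forall y \near x, `|v y - v x| <= e / (4 * L).
  by move/cvgrPdist_le : cv => /(_ _ e3); apply: filterS => y; rewrite distrC.
have n4 : \forall y \near x, `|(p y : R^o) - p x| <= e / (4 * Cv).
  by move/cvgrPdist_le : cp => /(_ _ e4); apply: filterS => y; rewrite distrC.
have n5 : \forall y \near x, `|(p y : R^o) - p x| <= 1.
  by move/cvgrPdist_le : cp => /(_ _ e5); apply: filterS => y; rewrite distrC.
have {}n3 := near_pair_and n3; have {}n4 := near_pair_and n4.
have {}n5 := near_pair_and n5.
have := near_pairI (near_pairI n3 (near_pairI n4 n5))
  (near_pairI lp (near_pairI (hp _ e2) (hv _ e1))).
apply: near_pairS => y z [[[_ vz] [[py _] [py1 _]]] [lpyz [hpyz hvyz]]].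
(* Four terms, each at most [e / 4] times [|y - z|]: the error of [v], the variation of [p] against
   [Dv], the error of [p], and a product of two increments. *)
rewrite (_ : _ - _ - _ = p y *: (v y - v z - Dv (y - z)) +
   (p y - p x) *: Dv (y - z) + (p y - p z - Dp (y - z)) *: v x +
   (p y - p z) *: (v z - v x)); last first.
  rewrite !scalerBl !scalerBr.
  set A := p y *: v y; set B := p y *: v z; set C := p y *: Dv _.
  set E := p x *: Dv _; set F := p z *: v z; set G := p y *: v x.
  set H := p z *: v x; set I := Dp _ *: _.
  apply/eqP; rewrite -subr_eq0; apply/eqP.
  rewrite !opprD !opprK.
  rewrite !addrA.
  have -> : A - F - E - I - A + B + C - C + E - G + H + I - B + G + F - H =
     (A - A) + (F - F) + (E - E) + (I - I) + (B - B) + (C - C) + (G - G) + (H - H).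
    rewrite (AC 16 ((1*5)*(15*2)*(9*3)*(12*4)*(6*13)*(7*8)*(14*10)*(11*16)))/=.
    by [].
  by rewrite !subrr !addr0.
have pyB : `|p y| <= `|p x| + 1.
  by rewrite -[p y](subrK (p x)) (le_trans (ler_normD _ _))// addrC lerD.
set t := `|y - z| in lpyz hpyz hvyz *; have t0 : 0 <= t by exact: normr_ge0.
rewrite (_ : e * t = e / 4 * t + e / 4 * t + e / 4 * t + e / 4 * t); last by field.
apply: le_trans (ler_normD _ _) _; apply: lerD; [
  apply: le_trans (ler_normD _ _) _; apply: lerD; [
  apply: le_trans (ler_normD _ _) _; apply: lerD | ] | ]; rewrite normrZ.
- apply: (@le_trans _ _ ((`|p x| + 1) * (e / (4 * (`|p x| + 1)) * t))).
    by rewrite ler_pM.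
  rewrite le_eqVlt; apply/orP; left; apply/eqP; field.
  by rewrite gt_eqF// ltr_wpDl.
- apply: (@le_trans _ _ (e / (4 * Cv) * (Cv * t))); first by rewrite ler_pM.
  by rewrite le_eqVlt; apply/orP; left; apply/eqP; field; rewrite gt_eqF.
- apply: (@le_trans _ _ (e / (4 * (`|v x| + 1)) * t * (`|v x| + 1))).
    by rewrite ler_pM// lerDl.
  rewrite le_eqVlt; apply/orP; left; apply/eqP; field.
  by rewrite gt_eqF// ltr_wpDl.
- apply: (@le_trans _ _ (L * t * (e / (4 * L)))); first by rewrite ler_pM.
  by rewrite le_eqVlt; apply/orP; left; apply/eqP; field; rewrite gt_eqF.
Qed.

End StrictDifferentiability.

(** * The sup norm on matrices, and strict differentiability of C^1 maps *)

Section MatrixNorm.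
Context {R : realType}.

Lemma mx_coord_le m n (A : 'M[R]_(m, n)) i j : `|A i j| <= `|A|.
Proof.
rewrite [leRHS]/Num.norm /= mx_normrE; apply/bigmax_geP; right => /=.
by exists (i, j).
Qed.

Lemma mx_norm_le m n (A : 'M[R]_(m, n)) c :
  0 <= c -> (forall i j, `|A i j| <= c) -> `|A| <= c.
Proof.
move=> c0 Ac; rewrite [leLHS]/Num.norm /= mx_normrE.
by apply/bigmax_leP; split => // -[i j] _; exact: Ac.
Qed.

Lemma mulmx_norm_le m n p (A : 'M[R]_(m, n)) (B : 'M[R]_(n, p)) :
  `|A *m B| <= n%:R * `|A| * `|B|.
Proof.
apply: mx_norm_le => [|i j]; first by rewrite !mulr_ge0.
rewrite mxE (le_trans (ler_norm_sum _ _ _))//.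
rewrite -mulrA mulr_natl -[n in _ *+ n]card_ord -sumr_const.
by apply: ler_sum => k _; rewrite normrM ler_pM// mx_coord_le.
Qed.

Lemma bounded_linear_mulmx n p (B : 'M[R]_(n, p)) :
  bounded_linear (fun v : 'rV[R]_n => v *m B).
Proof.
split=> [a x y|]; first by rewrite mulmxDl scalemxAl.
exists (n%:R * `|B| + 1) => [|v]; first by rewrite ltr_wpDl// mulr_ge0.
rewrite (le_trans (mulmx_norm_le _ _))// mulrAC ler_wpM2r// lerDl//.
Qed.

Lemma continuous_norm (U V : normedModType R) (F : U -> V) (u : U) e :
  {for u, continuous F} -> 0 < e ->
  exists2 d : R, 0 < d & forall v, `|v - u| < d -> `|F v - F u| < e.
Proof.
move=> /cvgrPdist_lt Fu e0; apply/nearP_norm.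
by apply: filterS (Fu e e0) => v; rewrite distrC.
Qed.

(** Subtracting the linear term [t *: A] shifts a difference quotient by exactly [A]; this yields
    the derivative of [psi] in the mean value argument below. *)
Lemma quotient_coord n (A B P Q : 'rV[R]_n) (h t : R) j : h != 0 ->
  (P - A) 0 j - h^-1 *: ((Q - (h + t) *: A) 0 j - (B - t *: A) 0 j) =
  (P - h^-1 *: (Q - B)) 0 j.
Proof. by move=> h0; rewrite !mxE /GRing.scale/=; field. Qed.

(** The mean value theorem is applied, one coordinate at a time, to [f] minus its linear part along
    the segment from [z] to [y]. The intermediate Jacobian is within [e / (n + 1)] of the one at
    [u], and multiplying by a matrix costs a factor [n] in the sup norm. *)
Lemma C1_at_strict_derivative n (f : 'rV[R]_n -> 'rV[R]_n) u :
  C1_at f u -> strict_derivative f u (fun v => v *m 'J f u).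
Proof.
move=> [fdiff Jcont] e e0.
have e1 : 0 < e / (n%:R + 1) by rewrite divr_gt0// ltr_wpDl.
have [d1 d10 dJ] := continuous_norm Jcont e1.
have [d2 d20 dD] : exists2 d : R, 0 < d & forall v, `|v - u| < d -> differentiable f v.
  exact/nearP_norm.
pose d := Num.min d1 d2.
have d0 : 0 < d by rewrite lt_min d10.
have dP v : `|v - u| < d -> differentiable f v /\ `|'J f v - 'J f u| <= e / (n%:R + 1).
  by rewrite lt_min => /andP[v1 v2]; split; [exact: dD|exact/ltW/dJ].
have := near_pair_and (near_norm u d0); apply: near_pairS => y z [yd zd].
apply: mx_norm_le => [|i j]; first by rewrite mulr_ge0// ltW.
rewrite ord1 {i}.
set w := y - z; pose path (t : R) := z + t *: w.
have pathd (t : R) : t \in `[0, 1]%R -> `|path t - u| < d.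
  rewrite in_itv/= => /andP[t0 t1].
  rewrite (_ : path t - u = (1 - t) *: (z - u) + t *: (y - u)); last first.
    rewrite /path /w !scalerBr !scalerBl !scale1r !opprB.
    apply/rowP => k; rewrite !mxE; ring.
  rewrite (le_lt_trans (ler_normD _ _))// !normrZ (ger0_norm t0) ger0_norm ?subr_ge0//.
  have [->|tn0] := eqVneq t 0; first by rewrite subr0 mul1r mul0r addr0.
  rewrite (_ : d = (1 - t) * d + t * d); last by ring.
  apply: ler_ltD; first by rewrite ler_wpM2l ?subr_ge0// ltW.
  by rewrite ltr_pM2l// lt_def tn0.
have [A AE] : exists A, A = w *m 'J f u :> 'rV[R]_n by exists (w *m 'J f u).
pose psi (t : R) : R := (f (path t) - t *: A) 0 j.
pose dpsi (t : R) : R := (w *m 'J f (path t) - A) 0 j.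
have dpsiP (t : R) : t \in `[0, 1]%R -> is_derive t 1 psi (dpsi t).
  move=> t01; have [df _] := dP _ (pathd t t01).
  have dq : (fun h : R => h^-1 *: (f (h *: w + path t) - f (path t))) @ 0^'
      --> w *m 'J f (path t).
    by rewrite -deriveEjacobian//; exact: diff_derivable.
  have psiq : (fun h : R => h^-1 *: (psi (h *: (1 : R) + t) - psi t)) @ 0^'
      --> dpsi t.
    apply/cvgrPdist_le => e' e'0.
    have dqe := proj1 (@cvgrPdist_le _ _ _ _ _ _ _) dq _ e'0.
    near=> h.
    have h0 : h != 0 by near: h; exact: nbhs_dnbhs_neq.
    have hq : `|w *m 'J f (path t) - h^-1 *: (f (h *: w + path t) - f (path t))| <= e'.
      by near: h; exact: dqe.
    apply: le_trans hq; apply: le_trans (mx_coord_le _ 0 j).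
    rewrite le_eqVlt; apply/orP; left; apply/eqP; congr (`|_|).
    rewrite /dpsi /psi [h *: 1]mulr1 (_ : path (h + t) = h *: w + path t); last first.
      by rewrite /path scalerDl addrCA.
    exact: quotient_coord.
  by apply: DeriveDef; [apply/cvg_ex; exists (dpsi t)|exact: cvg_lim].
have psicont : {within `[0, 1], continuous psi}.
  apply: derivable_within_continuous => t t01.
  by have := dpsiP t t01 => -[].
have [c c01] := MVT_segment ler01 (fun t tI => dpsiP t (subset_itv_oo_cc tI)) psicont.
rewrite subr0 mulr1 => psiE.
rewrite -AE (_ : _ 0 j = psi 1 - psi 0); last first.
  rewrite /psi /path scale1r scale0r addr0 /w subrKC scale0r subr0 scale1r !mxE; ring.
rewrite psiE /dpsi AE -mulmxBr (le_trans (mx_coord_le _ _ _))// (le_trans (mulmx_norm_le _ _))//.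
have [_ Jd] := dP _ (pathd c c01).
rewrite mulrAC ler_wpM2r//.
apply: (@le_trans _ _ ((n%:R + 1) * (e / (n%:R + 1)))).
  by rewrite ler_pM// lerDl.
by rewrite mulrC divfK// gt_eqF// ltr_wpDl.
Unshelve. all: by end_near. Qed.
End MatrixNorm.

(** * Lipschitz bounds from compactness *)

Section CompactSupport.
Context {R : realType}.

Lemma compact_norm_le n (M : R) : compact [set x : 'rV[R]_n | `|x| <= M].
Proof.
apply: bounded_closed_compact.
  by exists M; split; [exact: num_real|move=> N MN x /= xM; exact: le_trans xM (ltW MN)].
rewrite (_ : [set _ | _] = closed_ball_ (fun x => `|x|) (0 : 'rV[R]_n) M); last first.
  by apply/seteqP; split => x; rewrite /closed_ball_/= sub0r normrN.
exact: closed_closed_ball_.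
Qed.

(** Compactness of [K x K] turns Lipschitz bounds near each pair of points into one bound on [K],
    uniform along the filter [F]. The filter is later a constant tending to infinity, or a dilation
    factor tending to 1. *)
Lemma lip_covering n m (I : Type) (F : set_system I) (FF : Filter F)
    (w : I -> 'rV[R]_n -> 'rV[R]_m) (c : I -> R) (r : R) : (0 < n)%N ->
  (\forall i \near F, 0 <= c i /\ forall x, r < `|x| -> w i x = 0) ->
  (forall a b : 'rV[R]_n, exists2 d : R, 0 < d &
     \forall i \near F, forall y z, `|y - a| < d -> `|z - b| < d ->
       `|w i y - w i z| <= c i * `|y - z|) ->
  \forall i \near F, lip (c i) (w i).
Proof.
move=> n0 w0 wl; pose r' := Num.max r 0 + 1; pose K := [set x : 'rV[R]_n | `|x| <= 3 * r'].
have r'0 : 0 < r' by rewrite /r' ltr_wpDl// le_max lexx orbT.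
have rr' : r < r' by rewrite /r' ltr_pwDr// le_max lexx.
have cK : compact (K `*` K) by apply: compact_setX; exact: compact_norm_le.
pose P i (p : 'rV[R]_n * 'rV[R]_n) := `|w i p.1 - w i p.2| <= c i * `|p.1 - p.2|.
have := proj1 (compact_near_coveringP _) cK I F P FF.
have H p : (K `*` K) p -> \forall p' \near p & i \near F, P i p'.
  case: p => a b _; have [d d0 dw] := wl a b.
  exists ([set q | `|q.1 - a| < d /\ `|q.2 - b| < d],
          [set i | forall y z, `|y - a| < d -> `|z - b| < d ->
            `|w i y - w i z| <= c i * `|y - z|]).
    split=> //=; exists ([set y | `|y - a| < d], [set z | `|z - b| < d]).
      by split; [exact: (near_norm a d0)|exact: (near_norm b d0)].
    by [].
  by move=> [[y z] i] /= [[yd zd] h]; exact: h.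
move=> /(_ H); apply: filterS2 w0 => i [ci0 wi0] wK y z.
(* A zero of [w i] in [K] that stands in for a far point [t]: if [|x| <= r'] and [|t| > 3 r'] then
   [|x - z0| <= 2 r' < |x - t|]. *)
pose z0 : 'rV[R]_n := const_mx r'.
have z0r : `|z0| = r'.
  apply/eqP; rewrite eq_le; apply/andP; split.
    by apply: mx_norm_le => [|k l]; rewrite ?mxE ?ger0_norm// ltW.
  have := mx_coord_le z0 0 (Ordinal n0).
  by rewrite mxE ger0_norm// ltW.
have away x t : `|x| <= r' -> 3 * r' < `|t| -> `|w i x - w i t| <= c i * `|x - t|.
  move=> xr tr; rewrite (wi0 t); last by lra.
  have /wK : (K `*` K) (x, z0) by split; rewrite /K/= ?z0r; lra.
  rewrite /P/= (wi0 z0) ?z0r// => /le_trans; apply.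
  rewrite ler_wpM2l// (le_trans (ler_normB _ _))// z0r.
  have := ler_normD (t - x) x; rewrite subrK distrC; lra.
have [yK|yK] := leP `|y| (3 * r'); have [zK|zK] := leP `|z| (3 * r').
- exact: (wK (y, z)).
- have [yr|yr] := leP `|y| r'; first exact: away.
  by rewrite !wi0 ?subrr ?normr0 ?mulr_ge0//; lra.
- have [zr|zr] := leP `|z| r'; first by rewrite distrC [`|y - _|]distrC; exact: away.
  by rewrite !wi0 ?subrr ?normr0 ?mulr_ge0//; lra.
- by rewrite !wi0 ?subrr ?normr0 ?mulr_ge0//; lra.
Qed.

Lemma dist_near (V : normedModType R) (a b y z : V) (d : R) :
  `|y - a| < d -> `|z - b| < d -> `|a - b| - 2 * d < `|y - z|.
Proof.
move=> ya zb.
have := ler_normD (a - y) (y - b); rewrite addrA subrK => h1.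
have := ler_normD (y - z) (z - b); rewrite addrA subrK => h2.
rewrite distrC in ya; lra.
Qed.

(** Near the diagonal the local Lipschitz bound applies. Near a pair [a != b] the increment of [u]
    is bounded while [|y - z|] exceeds [|a - b| / 2], so a large constant suffices. *)
Lemma lip_compact_support n m (u : 'rV[R]_n -> 'rV[R]_m) (r : R) : (0 < n)%N ->
  (forall x, loclip u x) -> (forall x, r < `|x| -> u x = 0) ->
  exists2 C : R, 0 < C & lip C u.
Proof.
move=> n0 ul u0.
have cu (a : 'rV[R]_n) : exists2 d : R, 0 < d &
    forall v, `|v - a| < d -> `|u v - u a| < 1.
  by apply: continuous_norm => //; exact: loclip_continuous.
have := @lip_covering n m R (pinfty_nbhs R) _ (fun=> u) id r n0.
have h1 : \forall i \near +oo, 0 <= i :> R /\ forall x, r < `|x| -> u x = 0.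
  by near=> i; split => //; near: i; exact: nbhs_pinfty_ge.
have h2 (a b : 'rV[R]_n) : exists2 d : R, 0 < d &
     \forall i \near +oo, forall y z, `|y - a| < d -> `|z - b| < d ->
       `|u y - u z| <= i * `|y - z|.
  have [<-|ab] := eqVneq a b.
    have [C C0 [[A B] /= [/nearP_norm[d1 d10 dA] /nearP_norm[d2 d20 dB]] AB]] := ul a.
    exists (Num.min d1 d2); first by rewrite lt_min d10.
    near=> i => y z; rewrite !lt_min => /andP[ya _] /andP[_ za].
    apply: le_trans (AB (y, z) _) _; first by split; [exact: dA|exact: dB].
    by rewrite ler_wpM2r//; near: i; exact: nbhs_pinfty_ge.
  have [d1 d10 h1'] := cu a; have [d2 d20 h2'] := cu b.
  have ab0 : 0 < `|a - b| by rewrite normr_gt0 subr_eq0.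
  exists (Num.min (Num.min d1 d2) (`|a - b| / 4)); first by rewrite !lt_min d10 d20 divr_gt0.
  near=> i => y z; rewrite !lt_min => /andP[/andP[ya _] ya4] /andP[/andP[_ zb] zb4].
  have yz := dist_near ya4 zb4.
  have uyz : `|u y - u z| <= `|u a - u b| + 2.
    have := h1' _ ya; have := h2' _ zb.
    have := ler_normD (u y - u a) (u a - u z); rewrite addrA subrK.
    have := ler_normD (u a - u b) (u b - u z); rewrite addrA subrK.
    rewrite [`|u b - u z|]distrC; lra.
  apply: le_trans uyz _.
  apply: (@le_trans _ _ (i * (`|a - b| / 2))).
    rewrite -ler_pdivrMr; last by lra.
    by near: i; apply: nbhs_pinfty_ge; exact: num_real.
  by rewrite ler_wpM2l//; lra.
move=> /(_ _ h1 h2) h.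
have [C [C0 CL]] : exists C : R, 0 < C /\ lip C u.
  apply/(@filter_ex _ (pinfty_nbhs R) _ [set C | 0 < C /\ lip C u]).
  by near=> C; split; [near: C; exact: nbhs_pinfty_gt|near: C; exact: h].
by exists C.
Unshelve. all: by end_near. Qed.

Lemma scale_near (V : normedModType R) (a y : V) (s d : R) :
  1 < s -> `|y - a| < 1 -> `|y - a| < d / 2 -> s - 1 <= d / (2 * (`|a| + 1)) ->
  `|s *: y - a| < d.
Proof.
move=> s1 y1 yd sd.
rewrite (_ : s *: y - a = (s - 1) *: y + (y - a)); last first.
  by rewrite scalerBl scale1r addrA subrK.
rewrite (le_lt_trans (ler_normD _ _))// (splitr d) ler_ltD//.
rewrite normrZ gtr0_norm ?subr_gt0//.
apply: (@le_trans _ _ (d / (2 * (`|a| + 1)) * (`|a| + 1))).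
  apply: ler_pM => //; first by rewrite subr_ge0 ltW.
  have := ler_normD (y - a) a; rewrite subrK; lra.
by rewrite le_eqVlt; apply/orP; left; apply/eqP; field; rewrite gt_eqF// ltr_wpDl.
Qed.

Lemma subB_expand (V : zmodType) (a b c d x y : V) :
  a - b - (c - d) = (a - c - x) + (x - y) - (b - d - y).
Proof.
by rewrite addrA subrK !opprB !addrA subrK [LHS](AC 4 (1*4*3*2)).
Qed.

(** Near the diagonal the increments of [u] at the scaled and unscaled points are close to
    [D (s (y - z))] and [D (y - z)], which differ by [(s - 1) D (y - z)]. Away from it continuity
    makes the numerator small. Taking [s > 1] keeps the difference zero beyond radius [r]. *)
Lemma lip_dilation n (u : 'rV[R]_n -> 'rV[R]_n) (r e : R) : (0 < n)%N -> 0 < e ->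
  (forall x, sdiff u x) -> (forall x, r < `|x| -> u x = 0) ->
  exists2 s : R, 1 < s < 1 + e & lip e (fun x => u (s *: x) - u x).
Proof.
move=> n0 e0 us u0.
have at1 (d : R) : 0 < d -> \forall s \near (1 : R)^'+, 1 < s /\ s - 1 <= d.
  move=> d0; near=> s; split; first by near: s; exact: nbhs_right_gt.
  by rewrite lerBlDl; near: s; apply: nbhs_right_le; rewrite ltrDl.
have := @lip_covering n n R (1 : R)^'+ _ (fun s x => u (s *: x) - u x) (fun=> e) r n0.
have h1 : \forall s \near (1 : R)^'+, 0 <= e /\ forall x, r < `|x| -> u (s *: x) - u x = 0.
  near=> s; split; first exact: ltW.
  have s1 : 1 < s by near: s; exact: nbhs_right_gt.
  move=> x rx; rewrite !u0 ?subrr// normrZ gtr0_norm ?(lt_trans _ s1)//.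
  by rewrite (lt_le_trans rx)// ler_peMl// ltW.
have h2 (a b : 'rV[R]_n) : exists2 d : R, 0 < d &
     \forall s \near (1 : R)^'+, forall y z, `|y - a| < d -> `|z - b| < d ->
       `|u (s *: y) - u y - (u (s *: z) - u z)| <= e * `|y - z|.
  have [<-|ab] := eqVneq a b.
    have [D bD uD] := us a; have [C C0 hC] := bD.2.
    have e80 : 0 < e / 8 by rewrite divr_gt0.
    have [[A B] /= [/nearP_norm[d1 d10 dA] /nearP_norm[d2 d20 dB]] AB] := uD _ e80.
    pose d := Num.min d1 d2.
    have d0 : 0 < d by rewrite lt_min d10.
    have {dA dB AB} uyz y z : `|y - a| < d -> `|z - a| < d ->
        `|u y - u z - D (y - z)| <= e / 8 * `|y - z|.
      rewrite !lt_min => /andP[ya _] /andP[_ za]; apply: (AB (y, z)).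
      by split; [exact: dA|exact: dB].
    exists (Num.min 1 (d / 2)); first by rewrite lt_min ltr01 divr_gt0.
    near=> s => y z; rewrite !lt_min => /andP[y1 yd] /andP[z1 zd].
    have [s1 s2] : 1 < s /\ s - 1 <= 1 by near: s; exact: at1.
    have [_ sC] : 1 < s /\ s - 1 <= e / (4 * C).
      by near: s; apply: at1; rewrite divr_gt0// mulr_gt0.
    have [_ sd] : 1 < s /\ s - 1 <= d / (2 * (`|a| + 1)).
      by near: s; apply: at1; rewrite divr_gt0// mulr_gt0// ltr_wpDl.
    have k1 := uyz _ _ (scale_near s1 y1 yd sd) (scale_near s1 z1 zd sd).
    have k2 : `|u y - u z - D (y - z)| <= e / 8 * `|y - z| by apply: uyz; lra.
    rewrite -scalerBr normrZ gtr0_norm ?(lt_trans _ s1)// in k1.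
    set t := `|y - z| in k1 k2 *; have t0 : 0 <= t by exact: normr_ge0.
    have k3 : `|D (s *: (y - z)) - D (y - z)| <= e / 4 * t.
      rewrite -(bounded_linearB bD) -[X in _ - X]scale1r -scalerBl.
      rewrite (le_trans (hC _))// normrZ gtr0_norm ?subr_gt0// mulrA ler_wpM2r//.
      apply: (@le_trans _ _ (C * (e / (4 * C)))); first by rewrite ler_pM2l.
      by rewrite le_eqVlt; apply/orP; left; apply/eqP; field; rewrite gt_eqF.
    rewrite (_ : _ - _ = (u (s *: y) - u (s *: z) - D (s *: (y - z))) +
       (D (s *: (y - z)) - D (y - z)) - (u y - u z - D (y - z))); last first.
      exact: subB_expand.
    apply: le_trans (ler_normB _ _) _.
    have k4 := ler_normD (u (s *: y) - u (s *: z) - D (s *: (y - z))) (D (s *: (y - z)) - D (y - z)).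
    have k5 : e / 8 * (s * t) <= e / 4 * t.
      rewrite mulrA ler_wpM2r//; nra.
    have -> : e * t = e / 4 * t + e / 4 * t + e / 2 * t by field.
    have : e / 8 * t <= e / 2 * t by rewrite ler_wpM2r//; lra.
    lra.
  have ab0 : 0 < `|a - b| by rewrite normr_gt0 subr_eq0.
  have e1 : 0 < e * `|a - b| / 8 by rewrite divr_gt0// mulr_gt0.
  have cu (x : 'rV[R]_n) := continuous_norm (sdiff_continuous (us x)) e1.
  have [d1 d10 k1] := cu a; have [d2 d20 k2] := cu b.
  pose d := Num.min d1 d2.
  have d0 : 0 < d by rewrite lt_min d10.
  exists (Num.min (Num.min 1 (d / 2)) (`|a - b| / 4)); first by rewrite !lt_min ltr01 !divr_gt0.
  near=> s => y z; rewrite !lt_min => /andP[/andP[y1 yd] y4] /andP[/andP[z1 zd] z4].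
  have yz := dist_near y4 z4.
  have [s1 sa] : 1 < s /\ s - 1 <= d / (2 * (`|a| + 1)).
    by near: s; apply: at1; rewrite divr_gt0// mulr_gt0// ltr_wpDl.
  have [_ sb] : 1 < s /\ s - 1 <= d / (2 * (`|b| + 1)).
    by near: s; apply: at1; rewrite divr_gt0// mulr_gt0// ltr_wpDl.
  have sya := scale_near s1 y1 yd sa; have szb := scale_near s1 z1 zd sb.
  have da : d <= d1 by rewrite /d ge_min lexx.
  have db : d <= d2 by rewrite /d ge_min lexx orbT.
  have {}sya := lt_le_trans sya da; have {}szb := lt_le_trans szb db.
  have ya : `|y - a| < d1 by lra.
  have zb : `|z - b| < d2 by lra.
  have := k1 _ sya; have := k1 _ ya; have := k2 _ szb; have := k2 _ zb.
  have := ler_normB (u (s *: y) - u y) (u (s *: z) - u z).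
  have := ler_normB (u (s *: y) - u a) (u y - u a).
  have := ler_normB (u (s *: z) - u b) (u z - u b).
  rewrite !opprB !addrA !subrK.
  have : e * (`|a - b| / 2) <= e * `|y - z| by rewrite ler_pM2l//; lra.
  lra.
move=> /(_ _ h1 h2) h.
have [s [s1 sL]] : exists s : R, 1 < s < 1 + e /\ lip e (fun x => u (s *: x) - u x).
  apply/(@filter_ex _ ((1 : R)^'+) _ [set s : R | 1 < s < 1 + e /\ lip e (fun x => u (s *: x) - u x)]).
  near=> s; split; last by near: s; exact: h.
  apply/andP; split; first by near: s; exact: nbhs_right_gt.
  by near: s; apply: nbhs_right_lt; rewrite ltrDl.
by exists s.
Unshelve. all: by end_near. Qed.

End CompactSupport.

(** * Groups generated by small bi-Lipschitz maps *)

(* The library declares completeness and the norm of matrices in files that do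
   not see each other, so their join must be declared here. *)
HB.instance Definition _ (R : realType) (m n : nat) :=
  Complete.copy 'M[R]_(m, n) 'M[R]_(m, n).

Section Small.
Context {R : realType} {n : nat}.
Local Notation S := (sphere R n).
Implicit Types (f g h : S -> S) (x y : 'rV[R]_n) (eps : R).

Definition small eps f : Prop :=
  [/\ homeomorphism f, bi_lipschitz (1 + eps) f & forall p, chi (f p) p < eps].

(** Only a monoid by its constructors, but a group in effect, because the inverse of a small map is
    small ([small_inv]). *)
Inductive generated eps : (S -> S) -> Prop :=
| generated_id : generated eps id
| generated_cons g f : small eps g -> generated eps f -> generated eps (g \o f).

Lemma chi_ge0 (p q : S) : 0 <= chi p q.
Proof. exact: (@mdist_ge0 R S). Qed.

Lemma lip_chi_continuous (L : R) f : 0 < L ->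
  (forall p q, chi (f p) (f q) <= L * chi p q) -> continuous f.
Proof.
move=> L0 fL p U /nbhs_ballP[e e0 eU].
apply/nbhs_ballP; exists (e / L) => [|q]; first exact: divr_gt0.
rewrite ballEmdist/= => pq; apply: eU; rewrite ballEmdist/=.
apply: le_lt_trans (fL _ _) _.
by rewrite mulrC -ltr_pdivlMr.
Qed.

Lemma small_bi_lipschitz eps f g : 0 < eps -> cancel f g -> cancel g f ->
  bi_lipschitz (1 + eps) f -> (forall p, chi (f p) p < eps) -> small eps f.
Proof.
move=> e0 fK gK fL fe; have L0 : 0 < 1 + eps by rewrite addr_gt0.
split => //; split; first by apply: (lip_chi_continuous L0) => p q; case/andP: (fL p q).
exists g; split => //; apply: (lip_chi_continuous L0) => p q.
have /andP[+ _] := fL (g p) (g q); rewrite !gK => h.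
by rewrite mulrC -ler_pdivrMr.
Qed.

Lemma small_inv eps f : 0 < eps -> small eps f ->
  exists g, [/\ cancel f g, cancel g f & small eps g].
Proof.
move=> e0 [[_ [g [fK gK _]]] fL fe]; exists g; split => //.
have L0 : 0 < 1 + eps by rewrite addr_gt0.
apply: (@small_bi_lipschitz _ _ f) => // [p q|p].
  have /andP[] := fL (g p) (g q); rewrite !gK => h1 h2.
  by rewrite ler_pdivrMr// mulrC h2 mulrC -ler_pdivrMr.
by have := fe (g p); rewrite gK chi_sym.
Qed.

Lemma small_id eps : 0 < eps -> small eps id.
Proof.
move=> e0; apply: (@small_bi_lipschitz _ _ id) => // [p q|p]; last first.
  by rewrite chixx.
have L1 : 1 <= 1 + eps by rewrite lerDl ltW.
rewrite ler_pdivrMr ?(lt_le_trans _ L1)// mulrC.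
by rewrite ler_peMl ?chi_ge0.
Qed.

Lemma generated_small eps f : small eps f -> generated eps f.
Proof. by move=> sf; exact: (generated_cons sf (generated_id eps)). Qed.

Lemma generated_comp eps f g :
  generated eps f -> generated eps g -> generated eps (f \o g).
Proof. by move=> ff gg; elim: ff => // a b sa _ ih; exact: (generated_cons sa ih). Qed.

Lemma generated_inv eps f : 0 < eps -> generated eps f ->
  exists g, [/\ cancel f g, cancel g f & generated eps g].
Proof.
move=> e0; elim=> [|a b sa _ [b' [bK b'K gb']]].
  by exists id; split => //; exact: generated_id.
have [a' [aK a'K sa']] := small_inv e0 sa.
exists (b' \o a'); split; [exact: (can_comp aK bK)|exact: (can_comp b'K a'K)|].
by apply: generated_comp => //; exact: generated_small.
Qed.

Lemma generated_cancel_left eps f g h : 0 < eps -> generated eps f ->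
  generated eps h -> f \o g = h -> generated eps g.
Proof.
move=> e0 /(generated_inv e0)[f' [fK f'K gf']] gh fg.
have -> : g = f' \o h by rewrite -fg; apply/funext => p /=; rewrite fK.
exact: generated_comp.
Qed.

Lemma generated_inverse eps f g : 0 < eps -> cancel f g -> cancel g f ->
  generated eps f -> generated eps g.
Proof.
move=> e0 fK gK gf; apply: (generated_cancel_left e0 gf (generated_id eps)).
by apply/funext => p /=; rewrite gK.
Qed.

Lemma generated_composite eps f : 0 < eps -> generated eps f ->
  exists (m : nat) (g : 'I_m -> S -> S),
    [/\ (1 <= m)%N, f = composite g & forall k, small eps (g k)].
Proof.
move=> e0 gf.
have [s [s0 fs ss]] : exists s : seq (S -> S), [/\ s != [::], f = foldr comp id s
    & forall i, (i < size s)%N -> small eps (nth id s i)].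
  elim: gf => [|a b sa _ [s [s0 -> ss]]].
    (* The identity is represented by a word of length one rather than the empty word, which secures
       [1 <= m]. *)
    by exists [:: id]; split => // -[|//] _; exact: small_id.
  by exists (a :: s); split => // -[|i]//= ; exact: ss.
exists (size s), (fun k => nth id s (rev_ord k)); split.
- by rewrite lt0n size_eq0.
- rewrite fs /composite; under eq_bigr do rewrite rev_ordK.
  by rewrite -(big_mkord xpredT (fun i => nth id s i)) -(big_nth id xpredT id) unlock.
- by move=> k; apply: ss; exact: ltn_ord.
Qed.

End Small.

(** * Maps of R^n near the identity are small on the sphere *)

Section NearIdentity.
Context {R : realType} {n : nat}.
Local Notation S := (sphere R n).
Implicit Types (h : 'rV[R]_n -> 'rV[R]_n) (x y : 'rV[R]_n).

Definition ext h (p : S) : S := if p is Some x then Some (h x) else None.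

Lemma ext_comp (h k : 'rV[R]_n -> 'rV[R]_n) : ext (h \o k) = ext h \o ext k.
Proof. by apply/funext => -[]. Qed.

Lemma ext_can (h k : 'rV[R]_n -> 'rV[R]_n) : cancel h k -> cancel (ext h) (ext k).
Proof. by move=> hK [x|]//=; rewrite hK. Qed.

Definition near_id (d : R) h : Prop :=
  lip d (fun x => h x - x) /\ `|h 0| <= d.

(** [chi] divides the Euclidean distance by both weights, and the distance to infinity is the
    reciprocal weight; bounds on weights therefore turn Euclidean bounds into bounds for [chi]. *)
Definition weight x : R := Num.sqrt (1 + enorm x ^+ 2).

Lemma weight_ge1 x : 1 <= weight x.
Proof. by rewrite -sqrtr1 ler_sqrt ?lerDl ?addr_ge0 ?sqr_ge0. Qed.

Lemma weight_gt0 x : 0 < weight x.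
Proof. exact: lt_le_trans (weight_ge1 x). Qed.

Lemma sqr_weight x : weight x ^+ 2 = 1 + enorm x ^+ 2.
Proof. by rewrite sqr_sqrtr// addr_ge0// sqr_ge0. Qed.

Lemma enorm_le_weight x : enorm x <= weight x.
Proof.
rewrite -(ler_pXn2r (n := 2))// ?nnegrE ?enorm_ge0 ?(ltW (weight_gt0 x))//.
by rewrite sqr_weight lerDr.
Qed.

(** [weight x] is the Euclidean length of the vector [(1, x)], hence 1-Lipschitz in [x]. *)
Lemma weight_triangle x y : weight y <= weight x + enorm (y - x).
Proof.
have xy : enorm y <= enorm x + enorm (y - x) by rewrite (le_trans _ (enormD _ _))// addrC subrK.
have yx0 := enorm_ge0 (y - x).
rewrite -(ler_pXn2r (n := 2))// ?nnegrE ?addr_ge0// ?(ltW (weight_gt0 _))//.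
rewrite sqrrD !sqr_weight.
have : enorm y ^+ 2 <= (enorm x + enorm (y - x)) ^+ 2.
  by rewrite ler_pXn2r ?nnegrE ?addr_ge0 ?enorm_ge0.
have := enorm_le_weight x; nra.
Qed.

Lemma norm_le_enorm x : `|x| <= enorm x.
Proof.
apply: mx_norm_le => [|i j]; first exact: enorm_ge0.
rewrite ord1 -sqrtr_sqr ler_wsqrtr// /sqnorm (bigD1 j)//= lerDl.
by apply: sumr_ge0 => k _; exact: sqr_ge0.
Qed.

Lemma enorm_le_norm x : enorm x <= n%:R * `|x|.
Proof.
case: (posnP n) => [n0|n0].
  rewrite {1}/enorm (_ : sqnorm x = 0) ?sqrtr0 ?mulr_ge0//.
  by apply: big1 => i _; have := ltn_ord i; rewrite [X in (_ < X)%N]n0.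
rewrite -(ler_pXn2r (n := 2))// ?nnegrE ?enorm_ge0 ?mulr_ge0//.
rewrite sqr_enorm exprMn.
apply: (@le_trans _ _ (n%:R * `|x| ^+ 2)).
  rewrite mulr_natl -[n in _ *+ n]card_ord -sumr_const; apply: ler_sum => i _.
  by rewrite -real_normK ?num_real// ler_pXn2r ?nnegrE// mx_coord_le.
by rewrite ler_wpM2r ?sqr_ge0// -natrX ler_nat leq_pmull.
Qed.

(** [h] is the identity plus a contraction. It expands by at least [1 - d], which gives injectivity
    and the Lipschitz inverse; a preimage of [y] is the Banach fixed point of
    [x |-> y - (h x - x)]. *)
Lemma near_id_inv d h : 0 < d -> d < 1 -> lip d (fun x => h x - x) ->
  exists h', [/\ cancel h h', cancel h' h & lip (1 - d)^-1 h'].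
Proof.
move=> d0 d1 hl.
have low x y : (1 - d) * `|x - y| <= `|h x - h y|.
  have := hl x y; have := ler_normB (h x - h y) (h x - x - (h y - y)).
  rewrite (_ : _ - _ - (_ - _ - (_ - _)) = x - y); first lra.
  by apply/rowP => i; rewrite !mxE; ring.
have hinj : injective h.
  move=> x y hxy; apply/eqP; rewrite -subr_eq0 -normr_le0.
  by have := low x y; rewrite hxy subrr normr0 pmulr_rle0// subr_gt0.
have hsurj y : exists x, h x = y.
  pose T (x : 'rV[R]_n) : 'rV[R]_n := y - (h x - x).
  have Tf : set_fun setT setT T by [].
  pose F := mkfun_fun Tf.
  have Tc : is_contraction F.
    exists (NngNum (ltW d0)); split => //= -[x z] _ /=.
    rewrite /T opprB addrC addrA subrK distrC; exact: hl.
  have [x _ xE] := @banach_fixed_point R 'rV[R]_n setT F Tc closedT (ex_intro _ 0 I).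
  exists x; have : x = y - (h x - x) by [].
  by move=> /eqP; rewrite opprB addrA eq_sym subr_eq addrC (inj_eq (addrI _)) => /eqP.
have [h' h'K] := choice hsurj.
exists h'; split => // [x|y z]; first by apply: hinj; rewrite h'K.
by rewrite ler_pdivlMl ?subr_gt0// -[X in _ <= `|X - _|]h'K -[X in _ <= `|_ - X|]h'K.
Qed.

(** Distances and weights each change by a factor between [1 - k] and [1 + k], so [chi] changes by
    at most [(1 + k) / (1 - k)^2] upwards and [(1 + k)^2 / (1 - k)] downwards. For [k <= 1/4] both
    are at most [1 + 8 k <= 1 + eps]. *)
Lemma near_id_small (eps : R) : (0 < n)%N -> 0 < eps -> exists2 d : R, 0 < d < 1 &
  forall h, near_id d h -> small eps (ext h).
Proof.
move=> n0 e0; pose k := Num.min (1 / 4) (eps / 8).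
have k0 : 0 < k by rewrite lt_min !divr_gt0.
have k4 : k <= 1 / 4 by rewrite ge_min lexx.
have k8 : 8 * k <= eps.
  by rewrite mulrC -ler_pdivlMr// /k ge_min lexx orbT.
have N1 : 1 <= n%:R :> R by rewrite ler1n.
have N0 : 0 < n%:R :> R by rewrite ltr0n.
(* The factor [n] pays for passing from the sup norm to the Euclidean norm, and 2 for
   [|x| + 1 <= 2 * weight x] in the displacement bound. *)
pose d := k / (2 * n%:R).
have dE : n%:R * d = k / 2 by rewrite /d; field; rewrite gt_eqF.
have d0 : 0 < d by rewrite divr_gt0// mulr_gt0.
have d1 : d < 1 by nra.
exists d; first by rewrite d0.
move=> h [hl h0]; have [h' [hK h'K _]] := near_id_inv d0 d1 hl.
have hxy x y : enorm ((h x - x) - (h y - y)) <= k * enorm (x - y).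
  apply: le_trans (enorm_le_norm _) _.
  apply: (@le_trans _ _ (n%:R * (d * enorm (x - y)))).
    rewrite ler_pM2l// (le_trans (hl _ _))// ler_pM2l//; exact: norm_le_enorm.
  rewrite mulrA dE ler_wpM2r ?enorm_ge0//; lra.
have up x y : enorm (h x - h y) <= (1 + k) * enorm (x - y).
  have := enormD (h x - x - (h y - y)) (x - y); rewrite (_ : _ + _ = h x - h y).
    by have := hxy x y; lra.
  by apply/rowP => i; rewrite !mxE; ring.
have low x y : (1 - k) * enorm (x - y) <= enorm (h x - h y).
  have := enormD (h x - h y) (- (h x - x - (h y - y))); rewrite enormN (_ : _ + _ = x - y).
    by have := hxy x y; lra.
  by apply/rowP => i; rewrite !mxE; ring.
have disp x : enorm (h x - x) <= k * weight x.
  have : `|h x - x| <= d * (`|x| + 1).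
    have := hl x 0; rewrite !subr0; have := ler_normD (h x - x - h 0) (h 0).
    rewrite subrK; lra.
  move=> hx; apply: le_trans (enorm_le_norm _) _.
  apply: (@le_trans _ _ (n%:R * (d * (`|x| + 1)))); first by rewrite ler_pM2l.
  rewrite mulrA dE.
  have := norm_le_enorm x; have := enorm_le_weight x; have := weight_ge1 x.
  have := weight_ge1 x; nra.
have wup x : weight (h x) <= (1 + k) * weight x.
  by have := weight_triangle x (h x); have := disp x; lra.
have wlow x : (1 - k) * weight x <= weight (h x).
  have := weight_triangle (h x) x; have := disp x.
  rewrite -enormN opprB; lra.
have L0 : 0 < 1 + eps by rewrite addr_gt0.
have k10 : 0 < 1 - k by lra.
(* [a] and [b] are the numerators of [chi] before and after, [P] and [Q] the denominators: products
   of two weights, or a single weight when the other point is infinity. *)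
have key (a b P Q : R) : 0 <= a -> 0 < P -> 0 < Q -> (1 - k) * a <= b ->
    b <= (1 + k) * a -> (1 - k) ^+ 2 * P <= Q -> Q <= (1 + k) ^+ 2 * P ->
    a / P / (1 + eps) <= b / Q <= (1 + eps) * (a / P).
  move=> a0 P0 Q0 ab ba PQ QP; have aP : 0 <= a * P by rewrite mulr_ge0// ltW.
  apply/andP; split.
    rewrite ler_pdivrMr// mulrAC ler_pdivlMr// mulrAC ler_pdivrMr//.
    have h1 : a * Q <= (1 + k) ^+ 2 * (a * P) by rewrite mulrCA ler_wpM2l.
    have h2 : (1 - k) * (a * P) <= b * P by rewrite mulrA ler_pM2r.
    have h3 : (1 + eps) * ((1 - k) * (a * P)) <= (1 + eps) * (b * P) by rewrite ler_pM2l.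
    have h4 : (1 + k) ^+ 2 <= (1 + eps) * (1 - k).
      by have : (1 + 8 * k) * (1 - k) <= (1 + eps) * (1 - k); [rewrite ler_pM2r//; lra|nra].
    have : (1 + k) ^+ 2 * (a * P) <= (1 + eps) * (1 - k) * (a * P) by rewrite ler_wpM2r.
    lra.
  rewrite mulrA ler_pdivrMr// mulrAC ler_pdivlMr//.
  have h1 : b * P <= (1 + k) * (a * P) by rewrite mulrA ler_pM2r.
  have h2 : (1 - k) ^+ 2 * (a * P) <= a * Q by rewrite mulrCA ler_wpM2l.
  have h3 : (1 + eps) * ((1 - k) ^+ 2 * (a * P)) <= (1 + eps) * (a * Q) by rewrite ler_pM2l.
  have h4 : 1 + k <= (1 + eps) * (1 - k) ^+ 2.
    by have : (1 + 8 * k) * (1 - k) ^+ 2 <= (1 + eps) * (1 - k) ^+ 2; [rewrite ler_pM2r ?exprn_gt0//; lra|nra].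
  have : (1 + k) * (a * P) <= (1 + eps) * (1 - k) ^+ 2 * (a * P) by rewrite ler_wpM2r.
  lra.
have key1 x : 1 / weight x / (1 + eps) <= 1 / weight (h x) <= (1 + eps) * (1 / weight x).
  have w0 := weight_gt0 x; have := wup x; have := wlow x => wl wu.
  apply: key => //; try exact: weight_gt0; try lra.
    by apply: le_trans wl; rewrite ler_pM2r//; nra.
  by apply: le_trans wu _; rewrite ler_pM2r//; nra.
apply: (@small_bi_lipschitz _ _ _ _ (ext h')) => //; try exact: ext_can.
- move=> [x|] [y|]; rewrite /mdist/=; [|exact: key1|exact: key1|].
    apply: key; rewrite ?enorm_ge0 ?mulr_gt0 ?weight_gt0//.
      rewrite expr2 mulrACA; apply: ler_pM; [| |exact: wlow|exact: wlow].
        by rewrite mulr_ge0 ?sqrtr_ge0// ltW.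
      by rewrite mulr_ge0 ?sqrtr_ge0// ltW.
    rewrite expr2 mulrACA.
    by apply: ler_pM; [exact: sqrtr_ge0|exact: sqrtr_ge0|exact: wup|exact: wup].
  by rewrite mul0r mulr0 lexx.
- move=> [x|]//=.
  have w0 := weight_gt0 x; have w1 := weight_ge1 (h x).
  rewrite -/(weight x) -/(weight (h x)).
  rewrite ltr_pdivrMr ?mulr_gt0 ?weight_gt0//.
  apply: le_lt_trans (disp x) _.
  apply: (@lt_le_trans _ _ (eps * weight x)); first by rewrite ltr_pM2r//; lra.
  by rewrite ler_pM2l// ler_peMl// ltW.
Qed.

End NearIdentity.

(** * Inversion and translations *)

Section Inversion.
Context {R : realType} {n : nat}.
Local Notation S := (sphere R n).
Implicit Types (x y : 'rV[R]_n) (eps : R).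

(* The rotation of the sphere that exchanges the two charts. *)
Definition sinv (p : S) : S := if p is Some x then chart_inv false x else Some 0.

Lemma sinv_inf : sinv None = Some 0. Proof. by []. Qed.

Lemma sinv0 : sinv (Some 0) = None.
Proof. by rewrite /= /chart_inv eqxx. Qed.

Lemma sinv_neq0 x : x != 0 -> sinv (Some x) = Some (rinversion x).
Proof. by move=> x0; rewrite /= /chart_inv (negbTE x0). Qed.

Lemma sinvK : involutive sinv.
Proof.
case=> [x|]; last by rewrite /= eqxx.
rewrite /= /chart_inv; case: eqP => [->//|/eqP x0] /=.
by rewrite /chart_inv (negbTE (rinversion_neq0 x0)) rinversionK.
Qed.

Lemma sinv_chart_inv b x : sinv (chart_inv b x) = chart_inv (~~ b) x.
Proof. by case: b => //; exact: (sinvK (Some x)). Qed.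

Lemma chart_sinv b (p : S) : chart b (sinv p) = chart (~~ b) p.
Proof.
have r0 : rinversion (0 : 'rV[R]_n) = 0.
  by apply/rowP => i; rewrite !mxE oppr0; case: ifP; rewrite mulr0.
case: b; last by case: p => [x|]; [exact: (chart_invK false x)|exact: r0].
by case: p => [x|] //=; rewrite /chart_inv; case: eqP => [->|].
Qed.

Lemma chart_dom_sinv b (p : S) : chart_dom b (sinv p) <-> chart_dom (~~ b) p.
Proof.
rewrite /chart_dom/= (_ : pole R n b = sinv (pole R n (~~ b))); last first.
  by case: b => //=; rewrite eqxx.
by split => h pE; apply: h; [rewrite pE|exact: (can_inj sinvK)].
Qed.

Local Arguments sinv : simpl never.

Lemma sqnorm_rinversion x : sqnorm (rinversion x) = (sqnorm x)^-1.
Proof.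
rewrite /rinversion sqnormZ sqnorm_reflect0 sqr_enorm.
have [->|x0] := eqVneq (sqnorm x) 0; first by rewrite mulr0 invr0.
by field.
Qed.

Lemma reflect0Z a x : reflect0 (a *: x) = a *: reflect0 x.
Proof. by apply/rowP => i; rewrite !mxE; case: ifP; rewrite ?mulrN. Qed.

Lemma reflect0D x y : reflect0 (x + y) = reflect0 x + reflect0 y.
Proof. by apply/rowP => i; rewrite !mxE; case: ifP; rewrite ?opprD. Qed.

Lemma sqnorm_lin2 (a b : R) x y :
  sqnorm (a *: x + b *: y) =
  a ^+ 2 * sqnorm x + b ^+ 2 * sqnorm y + 2 * a * b * \sum_i x 0 i * y 0 i.
Proof.
rewrite sqnormD !sqnormZ; congr (_ + _).
rewrite -mulr_natl -mulrA -!mulrA; congr (_ * _); rewrite mulrA mulr_sumr.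
by apply: eq_bigr => i _; rewrite !mxE; ring.
Qed.

(** The classical distance formula for an inversion, squared. It is what makes [sinv] an isometry of
    [chi] away from 0 and infinity. *)
Lemma sqnorm_rinversionB x y : x != 0 -> y != 0 ->
  sqnorm (rinversion x - rinversion y) = sqnorm (x - y) / (sqnorm x * sqnorm y).
Proof.
move=> x0 y0; rewrite /rinversion !sqr_enorm -scalerN.
have -> : - reflect0 y = reflect0 (- y).
  by apply/rowP => i; rewrite !mxE; case: ifP.
rewrite -!reflect0Z -reflect0D sqnorm_reflect0 sqnorm_lin2.
have -> : x - y = 1 *: x + 1 *: (- y) by rewrite !scale1r.
rewrite sqnorm_lin2.
rewrite (_ : sqnorm (- y) = sqnorm y); last by rewrite -!sqr_enorm enormN.
by field; rewrite !sqnorm_eq0 x0 y0.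
Qed.

Lemma chi_finE x y :
  chi (Some x : S) (Some y) = Num.sqrt (sqnorm (x - y) / ((1 + sqnorm x) * (1 + sqnorm y))).
Proof.
have s0 z : 0 <= 1 + sqnorm (z : 'rV[R]_n) by rewrite addr_ge0// sqnorm_ge0.
rewrite /chi !sqr_enorm -sqrtrM// [RHS]sqrtrM ?sqnorm_ge0//.
by rewrite [in RHS]sqrtrV// mulr_ge0.
Qed.

Lemma chi_infE x : chi (Some x : S) None = Num.sqrt (1 + sqnorm x)^-1.
Proof. by rewrite /chi !sqr_enorm sqrtrV ?addr_ge0 ?sqnorm_ge0// div1r. Qed.

Lemma sqnorm0 : sqnorm (0 : 'rV[R]_n) = 0.
Proof. by apply/eqP; rewrite sqnorm_eq0. Qed.

Lemma chi_sinv (p q : S) : chi (sinv p) (sinv q) = chi p q.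
Proof.
have sp x : 0 < 1 + sqnorm x by rewrite ltr_pwDl// sqnorm_ge0.
have inf x : chi (sinv (Some x)) (sinv None) = chi (Some x) None.
  have [->|x0] := eqVneq x 0; first by rewrite sinv0 sinv_inf chi_sym.
  rewrite chi_infE sinv_inf sinv_neq0//.
  rewrite chi_finE subr0 sqnorm_rinversion sqnorm0; congr (Num.sqrt _).
  by field; rewrite sqnorm_eq0 x0 gt_eqF.
have fin0 x : chi (sinv (Some 0)) (sinv (Some x)) = chi (Some 0) (Some x).
  have [->|x0] := eqVneq x 0; first by rewrite sinv0 !chixx.
  rewrite sinv0 sinv_neq0//.
  rewrite chi_sym chi_infE chi_finE sub0r sqnorm_rinversion sqnorm0.
  rewrite (_ : sqnorm (- x) = sqnorm x); last by rewrite -!sqr_enorm enormN.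
  congr (Num.sqrt _).
  have := sp x; have : sqnorm x != 0 by rewrite sqnorm_eq0.
  move: (sqnorm x) => t t0 t1.
  have t2 : t + 1 != 0 by rewrite addrC gt_eqF.
  have t3 : 1 + t != 0 by rewrite gt_eqF.
  by field; rewrite t0 ?t2 ?t3.
case: p q => [x|] [y|]; last 3 first.
- exact: inf.
- by rewrite chi_sym inf chi_sym.
- by rewrite !chixx.
have [->|x0] := eqVneq x 0; first exact: fin0.
have [->|y0] := eqVneq y 0; first by rewrite chi_sym fin0 chi_sym.
rewrite !sinv_neq0// !chi_finE; congr (Num.sqrt _).
rewrite sqnorm_rinversionB// !sqnorm_rinversion.
have := sp x; have := sp y.
have : sqnorm x != 0 by rewrite sqnorm_eq0.
have : sqnorm y != 0 by rewrite sqnorm_eq0.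
move: (sqnorm x) (sqnorm y) (sqnorm (x - y)) => t u w u0 t0 u1 t1.
have t2 : t + 1 != 0 by rewrite addrC gt_eqF.
have t3 : 1 + t != 0 by rewrite gt_eqF.
have u2 : u + 1 != 0 by rewrite addrC gt_eqF.
have u3 : 1 + u != 0 by rewrite gt_eqF.
by field; rewrite t0 u0 ?t2 ?t3 ?u2 ?u3.
Qed.

Lemma small_sinv_conj eps f : 0 < eps -> small eps f -> small eps (sinv \o f \o sinv).
Proof.
move=> e0 [[_ [g [fK gK _]]] fL fe].
apply: (@small_bi_lipschitz _ _ _ _ (sinv \o g \o sinv)) => //.
- by move=> p /=; rewrite sinvK fK sinvK.
- by move=> p /=; rewrite sinvK gK sinvK.
- by move=> p q; rewrite /mdist/= chi_sinv -(chi_sinv p q); exact: fL.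
- by move=> p /=; rewrite -[X in chi _ X]sinvK chi_sinv.
Qed.

Lemma generated_sinv_conj eps f : 0 < eps -> generated eps f ->
  generated eps (sinv \o f \o sinv).
Proof.
move=> e0; elim=> [|a b sa _ ih].
  rewrite (_ : _ \o _ = id); first exact: generated_id.
  by apply/funext => p /=; rewrite sinvK.
rewrite (_ : _ \o _ = (sinv \o a \o sinv) \o (sinv \o b \o sinv)).
  exact: (generated_cons (small_sinv_conj e0 sa) ih).
by apply/funext => p /=; rewrite sinvK.
Qed.

Lemma generated_ext_iter eps (h : 'rV[R]_n -> 'rV[R]_n) N :
  generated eps (ext h) -> generated eps (ext (iter N h)).
Proof.
move=> gh; elim: N => [|N ih].
  rewrite (_ : ext _ = id); first exact: generated_id.
  by apply/funext => -[].
rewrite (_ : ext _ = ext h \o ext (iter N h)); first exact: generated_comp.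
by apply/funext => -[].
Qed.

Lemma exists_nat_gt (d M : R) : 0 < d -> exists2 N : nat, (0 < N)%N & M <= N%:R * d.
Proof.
move=> d0; exists (Num.truncn `|M / d|).+1 => //.
rewrite -ler_pdivrMr//; apply: le_trans (ler_norm _) _; apply: ltW.
exact: truncnS_gt.
Qed.

Lemma generated_translation eps (v : 'rV[R]_n) : (0 < n)%N -> 0 < eps ->
  generated eps (ext (fun x => x + v)).
Proof.
move=> n0 e0; have [d /andP[d0 _] dP] := near_id_small (R := R) n0 e0.
have [N N0 NP] := exists_nat_gt `|v| d0.
have Nr : 0 < N%:R :> R by rewrite ltr0n.
pose h (x : 'rV[R]_n) := x + N%:R^-1 *: v.
have -> : (fun x => x + v) = iter N h.
  apply/funext => x.
  have E k : iter k h x = x + (k%:R / N%:R) *: v.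
    elim: k => [|k ih]; first by rewrite mul0r scale0r addr0.
    by rewrite iterS ih /h -addrA -scalerDl -natr1 mulrDl mul1r.
  by rewrite E divff ?scale1r// gt_eqF.
apply/generated_ext_iter/generated_small/dP; split=> [x y|].
  by rewrite /h !(addrC _ (_ *: v)) !addrK subrr normr0 mulr_ge0// ltW.
rewrite /h add0r normrZ gtr0_norm ?invr_gt0//.
by rewrite ler_pdivrMl.
Qed.

(* With t the translation by the first basis vector, (t sinv)^3 = 1 as for
   z |-> z + 1 and z |-> -1/z, hence sinv = t (sinv t sinv) t. *)
Lemma generated_sinv eps : (0 < n)%N -> 0 < eps -> generated eps sinv.
Proof.
move=> n0 e0; pose i0 := Ordinal n0; pose e : 'rV[R]_n := \row_i (i == i0)%:R.
pose t := ext (fun x => x + e).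
have gt : generated eps t by exact: generated_translation.
suff -> : sinv = t \o (sinv \o t \o sinv) \o t.
  apply: generated_comp => //; apply: generated_comp => //.
  exact: generated_sinv_conj.
have dote x : \sum_i x 0 i * e 0 i = x 0 i0.
  rewrite (bigD1 i0)//= big1 => [|i ii0]; rewrite mxE ?eqxx ?mulr1 ?addr0//.
  by rewrite (negbTE ii0) mulr0.
have e1 : sqnorm e = 1.
  rewrite -[LHS](_ : \sum_i e 0 i * e 0 i = _); first by rewrite dote mxE eqxx.
  by apply: eq_bigr => i _; rewrite expr2.
have en0 : e != 0 by rewrite -sqnorm_eq0 e1 oner_eq0.
have ref x : reflect0 x = x - (2 * x 0 i0) *: e.
  apply/rowP => i; rewrite !mxE; have -> : (i == 0%N :> nat) = (i == i0) by [].
  by case: eqP => [->|_]; rewrite ?mulr1 ?mulr0 ?subr0//; ring.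
have re : rinversion e = - e.
  rewrite /rinversion sqr_enorm e1 invr1 scale1r ref mxE eqxx mulr1.
  by rewrite scaler_nat mulr2n opprD addrA subrr add0r.
apply/funext => -[x|]; last first.
  by rewrite /= sinv_inf /= add0r sinv_neq0//= re addNr.
have [->|x0] := eqVneq x 0.
  by rewrite sinv0 /= add0r sinv_neq0//= re addNr sinv0.
rewrite /t /=.
have [/eqP|xe0] := eqVneq (x + e) 0.
  rewrite addr_eq0 => /eqP ->; rewrite addNr sinv0 /= add0r.
  by rewrite -re sinv_neq0 ?rinversion_neq0// rinversionK.
rewrite (sinv_neq0 x0) (sinv_neq0 xe0) /=.
have N1E : sqnorm (x + e) = sqnorm x + 2 * x 0 i0 + 1.
  by rewrite sqnormD e1 dote -mulr_natl; ring.
have N0 : sqnorm x != 0 by rewrite sqnorm_eq0.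
have N10 : sqnorm (x + e) != 0 by rewrite sqnorm_eq0.
set N := sqnorm x in N1E N0; set N1 := sqnorm (x + e) in N1E N10.
(* [reflect0 z] is what [t], [sinv], [t] make of [x]. Writing [z] as a combination of [x + e] and
   [e] lets [sqnorm_lin2] compute its squared norm, [N / N1]. *)
pose z := N1^-1 *: (x + e) + (- 1) *: e.
have zE : rinversion (x + e) + e = reflect0 z.
  rewrite /z reflect0D !reflect0Z /rinversion sqr_enorm -/N1.
  by rewrite [reflect0 e]ref mxE eqxx mulr1 scaler_nat mulr2n opprD addrA subrr add0r scaleN1r opprK.
have z2 : sqnorm z = N / N1.
  rewrite /z sqnorm_lin2 -/N1 e1 dote !mxE eqxx/=.
  have -> : N = N1 - 2 * x 0 i0 - 1 by rewrite N1E; ring.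
  by field.
have z0 : z != 0 by rewrite -sqnorm_eq0 z2 mulf_neq0// invr_neq0.
have rz0 : reflect0 z != 0 by rewrite -sqnorm_eq0 sqnorm_reflect0 sqnorm_eq0.
rewrite zE (sinv_neq0 rz0) /=; congr Some.
rewrite /rinversion !sqr_enorm sqnorm_reflect0 reflect0K z2 -/N ref.
have -> : 2 * x 0 i0 = N1 - N - 1 by rewrite N1E; ring.
by apply/rowP => i; rewrite !mxE; field; rewrite N0 N10.
Qed.

End Inversion.

Arguments sinv : simpl never.

(** * Compactly supported diffeomorphisms *)

Section SelfSimilar.
Context {R : realType} {n : nat} (L : R).
Hypothesis L1 : 1 < L.
Implicit Types (x y : 'rV[R]_n) (u v p q : 'rV[R]_n -> 'rV[R]_n).

Let L0 : 0 < L. Proof. exact: lt_trans L1. Qed.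
Let Lk0 k : 0 < L ^+ k. Proof. exact: exprn_gt0. Qed.
Let Lkn0 k : L ^+ k != 0. Proof. by rewrite gt_eqF. Qed.

(** Half-open, so that its images under the integer powers of [x |-> L x] partition the nonzero
    vectors. *)
Definition annulus x : Prop := 1 <= `|x| < L.

(* The exponent k >= 0 with L^k x in the annulus, and 0 if there is none. *)
Definition level x : nat := xget 0%N [set k | annulus (L ^+ k *: x)].

Lemma annulus_uniq x j k :
  annulus (L ^+ j *: x) -> annulus (L ^+ k *: x) -> j = k.
Proof.
wlog : j k / (j <= k)%N => [H aj ak|].
  by have [/H|/ltnW/H] := leqP j k; [exact|move=> /(_ ak aj)].
rewrite leq_eqVlt => /orP[/eqP//|jk].
rewrite /annulus !normrZ !gtr0_norm// => /andP[j1 _] /andP[_ kL].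
suff : L <= L ^+ k * `|x| by rewrite leNgt kL.
have -> : L ^+ k * `|x| = L * (L ^+ (k - j.+1) * (L ^+ j * `|x|)).
  by rewrite -(subnKC jk) addKn exprD exprS; ring.
rewrite -[leLHS]mulr1 ler_pM2l// -[leLHS]mulr1 ler_pM//.
by rewrite exprn_ege1// ltW.
Qed.

Lemma levelE x k : annulus (L ^+ k *: x) -> level x = k.
Proof.
move=> ak; rewrite /level; case: xgetP => [j _ aj|/(_ k)//].
exact: (@annulus_uniq x).
Qed.

(* If v maps the annulus to itself, spread v is the composition over all k >= 0
   of the conjugates of v by the dilation x |-> L^k x. *)
Definition spread v x : 'rV[R]_n := (L ^+ level x)^-1 *: v (L ^+ level x *: x).

(** At most the summand at [level x] is nonzero. The sum itself does not mention the level, so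
    values at points of different levels can be subtracted termwise. *)
Lemma spread_sum v x K : (forall y, ~ annulus y -> v y = 0) -> (level x < K)%N ->
  spread v x = \sum_(k < K) (L ^+ k)^-1 *: v (L ^+ k *: x).
Proof.
move=> v0 xK; rewrite (bigD1 (Ordinal xK))//= big1 ?addr0// => k kx.
rewrite v0 ?scaler0// => ak; move: kx; rewrite -val_eqE/= (levelE ak).
by rewrite eqxx.
Qed.

(** Conjugation by a dilation preserves Lipschitz constants. Two points of different levels involve
    only two of the copies, each vanishing at the other point, whence the factor 2. *)
Lemma spread_lip v c : 0 <= c -> (forall y, ~ annulus y -> v y = 0) ->
  lip c v -> lip (2 * c) (spread v).
Proof.
move=> c0 v0 vc x y.
have vk k : `|(L ^+ k)^-1 *: v (L ^+ k *: x) - (L ^+ k)^-1 *: v (L ^+ k *: y)|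
    <= c * `|x - y|.
  rewrite -scalerBr normrZ gtr0_norm ?invr_gt0// ler_pdivrMl//.
  apply: le_trans (vc _ _) _; rewrite -scalerBr normrZ gtr0_norm//.
  by rewrite mulrCA.
have cxy : 0 <= c * `|x - y| by rewrite mulr_ge0.
rewrite /spread; have [->|xy] := eqVneq (level x) (level y).
  by apply: le_trans (vk _) _; lra.
have vx : v (L ^+ level y *: x) = 0.
  by apply: v0 => /levelE /eqP; rewrite (negbTE xy).
have vy : v (L ^+ level x *: y) = 0.
  by apply: v0 => /levelE /eqP; rewrite eq_sym (negbTE xy).
have := vk (level x); rewrite vy scaler0 subr0.
have := vk (level y); rewrite vx scaler0 sub0r normrN.
have := ler_normB ((L ^+ level x)^-1 *: v (L ^+ level x *: x)) ((L ^+ level y)^-1 *: v (L ^+ level y *: y)).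
lra.
Qed.

Lemma spread_dilation u s x :
  (forall y, ~ annulus y -> u y = 0) ->
  (forall y, ~ annulus y -> u (s *: y) - u y = 0) ->
  spread u (s *: x) - spread u x = spread (fun y => u (s *: y) - u y) x.
Proof.
move=> u0 w0; pose K := (maxn (level x) (level (s *: x))).+1.
rewrite !(@spread_sum _ _ K)// ?ltnS ?leq_maxl ?leq_maxr// -sumrB.
by apply: eq_bigr => k _; rewrite scalerBr !scalerA (mulrC s).
Qed.

Section Fixing.
Context (p : 'rV[R]_n -> 'rV[R]_n).
Hypothesis pfix : forall y, ~ annulus y -> p y = y.
Hypothesis pann : forall y, annulus y -> annulus (p y).

(** [p] keeps the annulus in place, so [spread p] does not change the level of a point in one of its
    copies. *)
Lemma spread_comp q x : spread q (spread p x) = spread (q \o p) x.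
Proof.
have [ax|ax] := pselect (annulus (L ^+ level x *: x)).
  have E : L ^+ level x *: spread p x = p (L ^+ level x *: x).
    by rewrite /spread scalerA divff// scale1r.
  have ap := pann ax; rewrite -E in ap.
  by rewrite [in LHS]/spread (levelE ap) E.
have -> : spread p x = x.
  by rewrite /spread pfix// scalerA mulVf// scale1r.
by rewrite /spread /= (pfix ax).
Qed.

Lemma spread_fixE x : (forall k, ~ annulus (L ^+ k *: x)) -> spread p x = x.
Proof. by move=> ax; rewrite /spread pfix// scalerA mulVf// scale1r. Qed.

(** Conjugating [spread p] by [x |-> L x] leaves the copies of [p] with index at least 1; composing
    with [p] restores the copy of index 0. *)
Lemma spread_shift x : p (L^-1 *: spread p (L *: x)) = spread p x.
Proof.
have shift k : L ^+ k *: (L *: x) = L ^+ k.+1 *: x by rewrite scalerA -exprSr.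
have L1x y : L^-1 *: (L *: y) = y by rewrite scalerA mulVf ?scale1r// gt_eqF.
have [[k ak]|nk] := pselect (exists k, annulus (L ^+ k *: x)); last first.
  have ax k : ~ annulus (L ^+ k *: x) by move=> ak; apply: nk; exists k.
  rewrite !spread_fixE ?L1x ?pfix// => [a0|k]; last by rewrite shift.
  by apply: (ax 0%N); rewrite expr0 scale1r.
(* At level 0 the conjugated map fixes [x] and only [p] acts. At level [k + 1] it already gives
   [spread p x], which keeps that level and is therefore fixed by [p]. *)
case: k ak => [|k] ak.
  rewrite [spread p (L *: x)]spread_fixE => [|k].
    by rewrite L1x /spread (levelE ak) expr0 invr1 !scale1r.
  by rewrite shift => /(annulus_uniq ak).
have E : spread p x = L^-1 *: spread p (L *: x).
  rewrite /spread (levelE ak); rewrite -shift in ak; rewrite (levelE ak) shift.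
  by rewrite scalerA exprS invfM.
rewrite -E pfix// => a0.
have : annulus (L ^+ k.+1 *: spread p x).
  by rewrite /spread (levelE ak) scalerA divff// scale1r; exact: pann.
by have : annulus (L ^+ 0 *: spread p x); [rewrite expr0 scale1r|move=> /annulus_uniq h /h].
Qed.

End Fixing.

Lemma spread_id x : spread id x = x.
Proof. by rewrite /spread scalerA mulVf// scale1r. Qed.

Lemma spreadE p x : spread p x = x + spread (fun y => p y - y) x.
Proof.
rewrite [in RHS]/spread scalerBr scalerA mulVf// scale1r.
by rewrite addrCA subrr addr0.
Qed.

End SelfSimilar.

(** * Generating compactly supported diffeomorphisms *)

Section CompactlySupported.
Context {R : realType} {n : nat}.
Implicit Types (x y : 'rV[R]_n) (p q : 'rV[R]_n -> 'rV[R]_n).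

Lemma bernoulli_lt (s : R) N : 1 < s -> N%:R * (s - 1) < s ^+ N.
Proof.
move=> s1; have : 1 + N%:R * (s - 1) <= s ^+ N; last lra.
elim: N => [|N ih]; first by rewrite mul0r addr0 expr0.
rewrite exprSr -natr1; have N0 : 0 <= N%:R :> R by [].
have : (1 + N%:R * (s - 1)) * s <= s ^+ N * s by rewrite ler_pM2r//; lra.
have : 0 <= N%:R * (s - 1) * (s - 1) by rewrite !mulr_ge0//; lra.
lra.
Qed.

(* With F := spread q and D := (x |-> L x), q = F D^-1 F^-1 D; and for s close to
   1, F (x |-> s x) F^-1 is close to the identity in the Lipschitz sense since q
   is strictly differentiable. *)
Lemma generated_annulus eps q q' (r : R) : (0 < n)%N -> 0 < eps ->
  cancel q q' -> cancel q' q ->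
  (forall x, sdiff q x) -> (forall x, loclip q' x) ->
  (forall x, ~ (2 <= `|x| <= r) -> q x = x) -> generated eps (ext q).
Proof.
move=> n0 e0 qK q'K qs q'l qfix.
have [d /andP[d0 d1] dP] := near_id_small (R := R) n0 e0.
pose u x := q x - x; pose u' x := q' x - x.
have us x : sdiff u x.
  by apply: sdiffD => //; exact: sdiff_opp.
have u'l x : loclip u' x.
  have [C C0 hC] := q'l x; exists (C + 1); first by rewrite addr_gt0.
  apply: near_pairS hC => y z h; rewrite /u' opprB addrACA addrA addrC addrA.
  rewrite (_ : _ + _ = (q' y - q' z) - (y - z)); last first.
    by apply/rowP => i; rewrite !mxE; ring.
  by rewrite (le_trans (ler_normB _ _))// mulrDl mul1r lerD.
have q'fix x : ~ (2 <= `|x| <= r) -> q' x = x.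
  by move=> xr; rewrite -[in LHS](qfix _ xr) qK.
have far x : r < `|x| -> ~ (2 <= `|x| <= r) by move=> xr /andP[_]; rewrite leNgt xr.
have u0 x : ~ (2 <= `|x| <= r) -> u x = 0 by move=> xr; rewrite /u qfix// subrr.
have u'0 x : ~ (2 <= `|x| <= r) -> u' x = 0 by move=> xr; rewrite /u' q'fix// subrr.
have [C C0 u'C] := lip_compact_support n0 u'l (fun x xr => u'0 x (far x xr)).
(* [P - id] below is [(s - 1) + 2 e]-Lipschitz as a function of [F' y], where [F'] is
   [(1 + 2 C)]-Lipschitz and [s - 1 < e]; so [3 e (1 + 2 C) <= d] is what has to be arranged. *)
pose e := Num.min 1 (d / (3 * (1 + 2 * C))).
have C1 : 0 < 1 + 2 * C by lra.
have e'0 : 0 < e by rewrite lt_min ltr01 divr_gt0// mulr_gt0.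
have ed : 3 * e * (1 + 2 * C) <= d.
  by rewrite mulrAC mulrC -ler_pdivlMr ?mulr_gt0// /e ge_min lexx orbT.
have e1 : e <= 1 by rewrite /e ge_min lexx.
have [s /andP[s1 se] us_lip] := lip_dilation n0 e'0 us (fun x xr => u0 x (far x xr)).
have s0 : 0 < s by lra.
have sd : s - 1 <= d by nra.
have s10 : 0 < s - 1 by lra.
(* By Bernoulli's inequality this [N] makes [L = s^N] exceed [r], so the annulus contains the
   support of [q]. *)
have [N _ rN] := exists_nat_gt (Num.max (r + 1) 1) s10.
pose L := s ^+ N.
have NL : Num.max (r + 1) 1 < L by apply: le_lt_trans rN _; exact: bernoulli_lt.
have rL : r < L by apply: le_lt_trans NL; rewrite le_max; apply/orP; left; lra.
have L1 : 1 < L by apply: le_lt_trans NL; rewrite le_max lexx orbT.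
have L0 : L != 0 by rewrite gt_eqF//; lra.
have out x : ~ annulus L x -> ~ (2 <= `|x| <= r).
  by move=> ax /andP[x2 xr]; apply: ax; apply/andP; split; lra.
have qf x : ~ annulus L x -> q x = x by move/out/qfix.
have q'f x : ~ annulus L x -> q' x = x by move/out/q'fix.
have qa x : annulus L x -> annulus L (q x).
  move=> ax; have [//|/qf/(can_inj qK) aq] := pselect (annulus L (q x)).
  by rewrite aq.
have q'a x : annulus L x -> annulus L (q' x).
  move=> ax; have [//|/q'f/(can_inj q'K) aq] := pselect (annulus L (q' x)).
  by rewrite aq.
pose F := spread L q; pose F' := spread L q'.
have FK : cancel F F'.
  move=> x; rewrite /F /F' spread_comp// (_ : q' \o q = id) ?spread_id//.
  by apply/funext => y /=; rewrite qK.
have F'K : cancel F' F.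
  move=> x; rewrite /F /F' spread_comp// (_ : q \o q' = id) ?spread_id//.
  by apply/funext => y /=; rewrite q'K.
have F'lip : lip (1 + 2 * C) F'.
  move=> x y; rewrite /F' !(spreadE L1 q') opprD addrACA.
  rewrite (le_trans (ler_normD _ _))// mulrDl mul1r lerD//.
  by apply: spread_lip => //; [exact: ltW|move=> z /out/u'0].
(* The support starts at radius 2 while the annulus starts at 1: as [s <= 2], [u (s x)] also
   vanishes off the annulus. *)
have w0 x : ~ annulus L x -> u (s *: x) - u x = 0.
  move=> ax; rewrite !u0 ?subrr//; first exact: out.
  rewrite normrZ gtr0_norm// => /andP[x2 xr]; apply: ax; apply/andP; split.
    have : `|x| * s <= `|x| * 2 by rewrite ler_wpM2l//; lra.
    lra.
  have : 1 * `|x| <= s * `|x| by rewrite ler_wpM2r//; lra.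
  lra.
pose P := F \o (fun x => s *: x) \o F'.
have PE y : P y - y = (s - 1) *: F' y + spread L (fun z => u (s *: z) - u z) (F' y).
  rewrite -[X in _ - X]F'K /P /= /F !(spreadE L1 q) -/u.
  rewrite -spread_dilation//; last by move=> z /out/u0.
  by rewrite scalerBl scale1r opprD addrACA.
have Pnear : near_id d P.
  split=> [x y|].
    rewrite !PE opprD addrACA -scalerBr (le_trans (ler_normD _ _))//.
    have h1 := F'lip x y.
    have h2 := spread_lip L1 (ltW e'0) w0 us_lip (F' x) (F' y).
    rewrite normrZ gtr0_norm//.
    apply: (@le_trans _ _ (3 * e * `|F' x - F' y|)).
      have : (s - 1) * `|F' x - F' y| <= e * `|F' x - F' y| by rewrite ler_wpM2r//; lra.
      lra.
    apply: (@le_trans _ _ (3 * e * ((1 + 2 * C) * `|x - y|))).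
      by rewrite ler_pM2l// mulr_gt0.
    by rewrite mulrA ler_wpM2r.
  have a0 : ~ annulus L (0 : 'rV[R]_n) by rewrite /annulus normr0 ler10.
  by rewrite /P /= /F /F' /spread !(scaler0, qf _ a0, q'f _ a0) normr0 ltW.
apply: (@generated_cancel_left _ _ _ (ext (iter N P)) _ (ext (iter N (fun x => s *: x)))) => //.
- by apply/generated_ext_iter/generated_small/dP.
- apply/generated_ext_iter/generated_small/dP; split; last by rewrite scaler0 normr0 ltW.
  move=> x y; rewrite (_ : _ - _ = (s - 1) *: (x - y)); last first.
    by apply/rowP => i; rewrite !mxE; ring.
  rewrite normrZ gtr0_norm//.
  by rewrite ler_wpM2r.
- have iters k x : iter k (fun x => s *: x) x = s ^+ k *: x.
    by elim: k => [|k ih]; rewrite ?expr0 ?scale1r// iterS ih scalerA exprS.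
  have iterP k x : iter k P x = F (iter k (fun x => s *: x) (F' x)).
    by elim: k => [|k ih]; rewrite ?F'K// !iterS ih /P /= FK.
  rewrite -ext_comp; congr ext; apply/funext => x /=.
  rewrite iterP !iters -/L.
  (* At the point [F^-1 (q x)], and after cancelling [q], the shift relation reads
     [D^-1 F D F^-1 q = id] with [D x = L x]. *)
  have := spread_shift L1 qf qa (F' (q x)); rewrite -/F F'K => /(can_inj qK) E.
  by rewrite -[in RHS]E [RHS]scalerA divff// scale1r.
Qed.

(** A translation by a vector of norm [r' + 2] moves the ball of radius [r'] into
    [2 <= |x| <= 2 r' + 2], where [generated_annulus] applies. *)
Lemma generated_compact_support eps q q' (r : R) : (0 < n)%N -> 0 < eps ->
  cancel q q' -> cancel q' q ->
  (forall x, sdiff q x) -> (forall x, loclip q' x) ->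
  (forall x, r < `|x| -> q x = x) -> generated eps (ext q).
Proof.
move=> n0 e0 qK q'K qs q'l qfix; pose r' := Num.max r 0.
have r'0 : 0 <= r' by rewrite le_max lexx orbT.
pose c : 'rV[R]_n := const_mx (r' + 2).
have cr : `|c| = r' + 2.
  have r2 : 0 <= r' + 2 by lra.
  apply/eqP; rewrite eq_le; apply/andP; split.
    by apply: mx_norm_le => // i j; rewrite mxE ger0_norm.
  by have := mx_coord_le c 0 (Ordinal n0); rewrite mxE ger0_norm.
have trans v x : sdiff (fun y => y + v) x.
  by apply: sdiffD; [exact: sdiff_id|exact: sdiff_cst].
pose conj p x := p (x - c) + c.
have gq : generated eps (ext (conj q)).
  apply: (@generated_annulus _ _ (conj q') (2 * r' + 2)) => //.
  - by move=> x; rewrite /conj addrK qK subrK.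
  - by move=> x; rewrite /conj addrK q'K subrK.
  - move=> x; apply: (sdiff_comp (u := fun y => y + c) (g := q \o (fun y => y - c))) => //.
    exact: sdiff_comp.
  - move=> x; apply: (loclip_comp (u := fun y => y + c) (g := q' \o (fun y => y - c))).
      exact: sdiff_loclip.
    by apply: loclip_comp => //; exact: sdiff_loclip.
  - move=> x xr; rewrite /conj qfix ?subrK// ltNge; apply/negP => xcr.
    apply: xr; have xcr' : `|x - c| <= r' by rewrite le_max xcr.
    have := ler_normD (x - c) c; rewrite subrK cr.
    have := ler_normB x (x - c); rewrite opprB addrC subrK cr => h1 h2.
    by apply/andP; split; lra.
rewrite (_ : ext q = ext (fun x => x - c) \o ext (conj q) \o ext (fun x => x + c)).
  apply: generated_comp; last exact: generated_translation.
  by apply: generated_comp => //; exact: generated_translation.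
by apply/funext => -[x|]//=; rewrite /conj !addrK.
Qed.

End CompactlySupported.

(** * Matrices of positive determinant *)

Section GeneralLinear.
Context {R : realType}.

Inductive mx_generated (d : R) n : 'M[R]_n -> Prop :=
| mx_generated1 : mx_generated d 1%:M
| mx_generated_cons M A :
    `|M - 1%:M| <= d -> mx_generated d A -> mx_generated d (M *m A).

Lemma mx_generated_mul d n (A B : 'M[R]_n) :
  mx_generated d A -> mx_generated d B -> mx_generated d (A *m B).
Proof.
by move=> gA gB; elim: gA => [|M C Md _ ih]; rewrite ?mul1mx -?mulmxA//; constructor.
Qed.

Lemma mx_generated_iter d n (M : 'M[R]_n) k : `|M - 1%:M| <= d ->
  mx_generated d (iter k (mulmx M) 1%:M).
Proof. by move=> Md; elim: k => [|k ih]; constructor. Qed.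

(** Since [N^2 = 0], the matrix [1 + N] is the [K]-th power of [1 + N / K]. *)
Lemma mx_generated_unipotent d n (N : 'M[R]_n) : 0 < d -> N *m N = 0 ->
  mx_generated d (1%:M + N).
Proof.
move=> d0 NN; have [K K0 KP] := exists_nat_gt `|N| d0.
have Kr : 0 < K%:R :> R by rewrite ltr0n.
pose M := 1%:M + K%:R^-1 *: N.
have E k : iter k (mulmx M) 1%:M = 1%:M + (k%:R / K%:R) *: N.
  elim: k => [|k ih]; first by rewrite mul0r scale0r addr0.
  rewrite iterS ih /M mulmxDl mulmxDr !mul1mx mulmxDr mulmx1.
  rewrite -scalemxAl -scalemxAr NN !scaler0 addr0 -addrA -scalerDl.
  by rewrite -natr1 mulrDl mul1r.
have := @mx_generated_iter d n M K; rewrite E divff ?gt_eqF// scale1r; apply.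
by rewrite /M addrC addKr normrZ gtr0_norm ?invr_gt0// ler_pdivrMl.
Qed.

Lemma mx_generated_block d n (A : 'M[R]_n) : 0 <= d -> mx_generated d A ->
  mx_generated d (block_mx (1%:M : 'M[R]_1) 0 0 A).
Proof.
move=> d0; elim=> [|M B Md _ ih].
  by rewrite -scalar_mx_block; constructor.
rewrite (_ : block_mx _ _ _ _ = block_mx (1%:M : 'M[R]_1) 0 0 M *m block_mx 1%:M 0 0 B).
  constructor => //; rewrite scalar_mx_block opp_block_mx add_block_mx.
  apply: mx_norm_le => // i j.
  case: (split_ordP i) => i' ->; case: (split_ordP j) => j' ->.
  - by rewrite block_mxEul subrr mxE normr0.
  - by rewrite block_mxEur subrr mxE normr0.
  - by rewrite block_mxEdl subrr mxE normr0.
  - by rewrite block_mxEdr; apply: le_trans Md; exact: mx_coord_le.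
by rewrite mulmx_block !mulmx0 !mul0mx !mulmx1 !addr0 !add0r.
Qed.

Lemma root_near1 (d a : R) : 0 < d -> 0 < a ->
  exists (c : R) (N : nat), `|c - 1| <= d /\ c ^+ N = a.
Proof.
move=> d0 a0.
have : (fun t : R => expR t) @ (0 : R) --> expR 0 by exact: continuous_expR.
rewrite expR0 => /cvgrPdist_lt/(_ _ d0) /(@nbhs_normP _ R^o)[e /= e0 eP].
have [N N0 NP] := exists_nat_gt (`|ln a| + 1) e0.
have Nr : 0 < N%:R :> R by rewrite ltr0n.
exists (expR (ln a / N%:R)), N; split; last first.
  by rewrite -expRM_natl mulrC divfK ?lnK// gt_eqF.
rewrite distrC; apply/ltW/eP; rewrite /ball_/= sub0r normrN normrM normfV.
rewrite [`|N%:R|]gtr0_norm// ltr_pdivrMr// mulrC; apply: lt_le_trans NP.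
by rewrite ltrDl.
Qed.

(** Induction on the size by block elimination: multiplication by the shears [U] and [W], which are
    generated and have determinant 1, reduces to [block_mx 1 0 0 D]. In size 1 a root close to 1 is
    extracted. *)
Lemma mx_generated_pos_det d n (A : 'M[R]_n) : 0 < d -> 0 < \det A ->
  mx_generated d A.
Proof.
move=> d0; elim: n A => [|[|n] ih] A detA.
- by rewrite (flatmx0 A) -(flatmx0 1%:M); constructor.
- rewrite (mx11_scalar A) in detA *; rewrite det_scalar1 in detA.
  have [c [N [cd <-]]] := root_near1 d0 detA.
  have -> : (c ^+ N)%:M = iter N (mulmx c%:M) 1%:M :> 'M[R]_1.
    by elim: N => //= N <-; rewrite -scalar_mxM exprS.
  apply: mx_generated_iter; apply: mx_norm_le => [|i j]; first exact: ltW.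
  by rewrite !mxE !ord1 eqxx.
pose U (v : 'rV[R]_n.+1) := block_mx (1%:M : 'M[R]_1) v 0 1%:M.
pose W (w : 'cV[R]_n.+1) := block_mx (1%:M : 'M[R]_1) 0 w 1%:M.
have gU v : mx_generated d (U v).
  rewrite (_ : U v = 1%:M + block_mx 0 v 0 0).
    apply: mx_generated_unipotent => //.
    by rewrite mulmx_block !mulmx0 !mul0mx !addr0 block_mx0.
  by rewrite [in RHS]scalar_mx_block add_block_mx !addr0 !add0r.
have gW w : mx_generated d (W w).
  rewrite (_ : W w = 1%:M + block_mx 0 0 w 0).
    apply: mx_generated_unipotent => //.
    by rewrite mulmx_block !mulmx0 !mul0mx !addr0 block_mx0.
  by rewrite [in RHS]scalar_mx_block add_block_mx !addr0 !add0r.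
pose simp := (mulmx0, mul0mx, mulmx1, mul1mx, addr0, add0r, addrN, addNr).
have UK v B : U (- v) *m (U v *m B) = B.
  by rewrite mulmxA mulmx_block !simp -scalar_mx_block mul1mx.
have WK w B : W (- w) *m (W w *m B) = B.
  by rewrite mulmxA mulmx_block !simp -scalar_mx_block mul1mx.
have KU v B : (B *m U v) *m U (- v) = B.
  by rewrite -mulmxA mulmx_block !simp -scalar_mx_block mulmx1.
have detU v : \det (U v) = 1 by rewrite det_ublock !det1 mulr1.
have detW w : \det (W w) = 1 by rewrite det_lblock !det1 mulr1.
pose G (B : 'M[R]_(1 + n.+1)) := 0 < \det B -> mx_generated d B.
have GU v B : G (U v *m B) -> G B.
  move=> GB B0; rewrite -(UK _ v B); apply: mx_generated_mul => //; apply: GB.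
  by rewrite det_mulmx detU mul1r.
have GW w B : G (W w *m B) -> G B.
  move=> GB B0; rewrite -(WK _ w B); apply: mx_generated_mul => //; apply: GB.
  by rewrite det_mulmx detW mul1r.
have GU' v B : G (B *m U v) -> G B.
  move=> GB B0; rewrite -(KU _ v B); apply: mx_generated_mul => //; apply: GB.
  by rewrite det_mulmx detU mulr1.
have Gdiag D : G (block_mx 1%:M 0 0 D).
  rewrite /G det_ublock det1 mul1r => D0.
  by apply: mx_generated_block; [exact: ltW|exact: ih].
have G1 u w D : G (block_mx 1%:M u w D).
  apply: (GW (- w)); apply: (GU' (- u)).
  by rewrite !mulmx_block !simp; exact: Gdiag.
(* A nonzero entry of [w] below the corner lets a row shear turn the corner into 1. *)
have G2 a u w D : w != 0 -> G (block_mx a u w D).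
  move=> w0; have [i wi] : exists i, w i 0 != 0.
    apply/existsP; apply: contraNT w0; rewrite negb_exists => /forallP w0.
    by apply/eqP/colP => i; rewrite mxE; apply/eqP; have := w0 i; rewrite negbK.
  apply: (GU (((1 - a 0 0) / w i 0) *: delta_mx 0 i)).
  rewrite mulmx_block !mul1mx -!scalemxAl.
  rewrite (_ : a + _ = 1%:M); first exact: G1.
  apply/matrixP => k l; rewrite !ord1 -rowE !mxE eqxx divfK//= mulr1n.
  by rewrite addrC subrK.
suff GA a u w D : G (block_mx a u w D).
  by move: detA; rewrite -[A](@submxK R 1 n.+1 1 n.+1); exact: GA.
have [w0|w0] := eqVneq w 0; last exact: G2.
have [a0|a0] := eqVneq a 0.
  by rewrite /G w0 det_ublock a0 det0 mul0r ltxx.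
(* The first column is zero below a nonzero corner; adding the top row to every other row makes it
   nonzero there. *)
apply: (GW (const_mx 1)); rewrite mulmx_block; apply: G2.
rewrite w0 mulmx0 addr0; apply: contraNneq a0 => /matrixP/(_ 0 0).
rewrite !mxE big_ord1 !mxE mul1r => a00.
by apply/eqP/matrixP => k l; rewrite !ord1 a00 mxE.
Qed.

End GeneralLinear.

(** * Cutoff functions *)

Section Cutoff.
Context {R : realType}.

Lemma sdiff_inv (a : R) : a != 0 -> sdiff (U := R^o) (V := R^o) (fun y => y^-1) a.
Proof.
move=> a0; exists (fun v : R^o => - (a^-1 ^+ 2) *: v).
  split=> [b x y|]; first by rewrite scalerDr !scalerA mulrC.
  exists (`|a^-1 ^+ 2| + 1) => [|v]; first by rewrite ltr_wpDl.
  by rewrite normrZ normrN ler_wpM2r// lerDl.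
move=> e e0; pose t := Num.min 1 (e / (2 * `|a^-1| + 1)).
have a1 : 0 < 2 * `|a^-1| + 1 by rewrite ltr_wpDl// mulr_ge0.
have t0 : 0 < t by rewrite lt_min ltr01 divr_gt0.
have te : (2 * `|a^-1| + 1) * t <= e.
  by rewrite mulrC -ler_pdivlMr// /t ge_min lexx orbT.
have t1 : t <= 1 by rewrite /t ge_min lexx.
have /(@continuous_norm _ R^o R^o)/(_ t0)[d d0 dP] :
    {for (a : R^o), continuous (fun y : R^o => y^-1 : R^o)} by exact: inv_continuous.
have h := near_pair_and (near_norm (a : R^o) d0).
have aa : 0 < `|a| by rewrite normr_gt0.
have h' := near_pair_and (near_norm (a : R^o) aa).
apply: near_pairS2 h h' => y z [/dP ya /dP za] [y0 z0].
have nz w : `|(w : R^o) - a| < `|a| -> w != 0.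
  by apply: contraTneq => ->; rewrite sub0r normrN ltxx.
rewrite (_ : _ - _ = (a^-1 * (a^-1 - z^-1) + z^-1 * (a^-1 - y^-1)) * (y - z)); last first.
  by rewrite /GRing.scale/=; field; rewrite a0 !nz.
rewrite normrM ler_wpM2r//.
have zB : `|z^-1| <= `|a^-1| + t.
  by have := ler_normD (z^-1 - a^-1) a^-1; rewrite subrK; lra.
apply: le_trans (ler_normD _ _) _; rewrite !normrM.
rewrite -normrN opprB in ya; rewrite -normrN opprB in za.
have h1 : `|a^-1| * `|a^-1 - z^-1| <= `|a^-1| * t by rewrite ler_wpM2l// ltW.
have h2 : `|z^-1| * `|a^-1 - y^-1| <= (`|a^-1| + t) * t by rewrite ler_pM// ltW.
have h3 : t * t <= 1 * t by rewrite ler_wpM2r// ltW.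
lra.
Qed.

(** With [m] the positive part, the error factors as [(m y - m z) ((m y - m a) + (m z - m a))] when
    [m a = 0] or when [m] is the identity near [a], and [m] is 1-Lipschitz. *)
Lemma sdiff_sqr_pos (a : R) :
  sdiff (U := R^o) (V := R^o) (fun y : R => Num.max 0 y ^+ 2) a.
Proof.
pose m (y : R) := Num.max 0 y.
have m0 y : 0 <= m y by rewrite le_max lexx.
have mL y z : `|m y - m z| <= `|y - z|.
  rewrite /m !maxEle; case: (leP 0 y) => y0; case: (leP 0 z) => z0 //.
  - by rewrite subr0 (ger0_norm y0) ger0_norm; lra.
  - by rewrite sub0r normrN (ger0_norm z0) ler0_norm; lra.
  - by rewrite subrr normr0.
exists (fun v : R^o => (2 * m a) *: v).
  split=> [b x y|]; first by rewrite scalerDr !scalerA mulrC.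
  exists (`|2 * m a| + 1) => [|v]; first by rewrite ltr_wpDl.
  by rewrite normrZ ler_wpM2r// lerDl.
move=> e e0; have e20 : 0 < e / 2 by rewrite divr_gt0.
have h := near_pair_and (near_norm (a : R^o) e20).
have key y z : `|y - a| < e / 2 -> `|z - a| < e / 2 ->
    (m a = 0 \/ (m y - m z = y - z)) ->
    `|m y ^+ 2 - m z ^+ 2 - (2 * m a) * (y - z)| <= e * `|y - z|.
  move=> ya za c.
  have -> : m y ^+ 2 - m z ^+ 2 - (2 * m a) * (y - z) =
      (m y - m z) * ((m y - m a) + (m z - m a)).
    by case: c => c; [rewrite c; ring|rewrite -c; ring].
  rewrite normrM mulrC ler_pM//.
  have := ler_normD (m y - m a) (m z - m a); have := mL y a; have := mL z a; lra.
have [a0|a0] := leP a 0.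
  have ma : m a = 0 by rewrite /m max_l.
  by apply: near_pairS h => y z [ya za]; apply: key => //; left.
have h' := near_pair_and (near_norm (a : R^o) a0).
apply: near_pairS2 h h' => y z [ya za] [ya' za']; apply: key => //; right.
have pos w : `|(w : R^o) - a| < a -> m w = w.
  by move=> wa; rewrite /m max_r//; move: wa; rewrite ltr_norml => /andP[+ _]; lra.
by rewrite !pos.
Qed.

(** A C^1 step from 1 on [s <= 1] to 0 on [2 <= s]; squaring makes the positive parts C^1, and the
    denominator never vanishes. *)
Definition plateau (s : R) : R :=
  Num.max 0 (2 - s) ^+ 2 / (Num.max 0 (2 - s) ^+ 2 + Num.max 0 (s - 1) ^+ 2).

Lemma plateau_den_gt0 s : 0 < Num.max 0 (2 - s) ^+ 2 + Num.max 0 (s - 1) ^+ 2 :> R.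
Proof.
have [s2|s2] := ltP s 2.
  by apply: ltr_pwDl; rewrite ?sqr_ge0// exprn_gt0// lt_max subr_gt0 s2 orbT.
apply: ltr_wpDl; rewrite ?sqr_ge0// exprn_gt0// lt_max subr_gt0.
by apply/orP; right; lra.
Qed.

Lemma plateau1 s : s <= 1 -> plateau s = 1.
Proof.
move=> s1; have := plateau_den_gt0 s; rewrite /plateau [Num.max 0 (s - 1)]max_l ?subr_le0//.
by rewrite expr0n/= addr0 => h; rewrite divff// gt_eqF.
Qed.

Lemma plateau0 s : 2 <= s -> plateau s = 0.
Proof.
by move=> s2; rewrite /plateau [Num.max 0 (2 - s)]max_l ?subr_le0// expr0n/= mul0r.
Qed.

Lemma plateau_ge0 s : 0 <= plateau s.
Proof. by rewrite divr_ge0 ?sqr_ge0// ltW// plateau_den_gt0. Qed.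

Lemma plateau_le1 s : plateau s <= 1.
Proof. by rewrite ler_pdivrMr ?plateau_den_gt0// mul1r lerDl sqr_ge0. Qed.

Lemma sdiff_plateau s : sdiff (U := R^o) (V := R^o) plateau s.
Proof.
have lin (a : R) (b : R) : sdiff (U := R^o) (V := R^o) (fun y => a * y + b) s.
  apply: sdiffD; last exact: sdiff_cst.
  apply: sdiff_bounded_linear; split=> [c x y|].
    by rewrite mulrDr /GRing.scale/= mulrCA.
  by exists (`|a| + 1) => [|v]; rewrite ?ltr_wpDl// normrM ler_wpM2r// lerDl.
have s1 : sdiff (U := R^o) (V := R^o) (fun y : R => Num.max 0 (2 - y) ^+ 2) s.
  have -> : (fun y : R => Num.max 0 (2 - y) ^+ 2) =
      (fun y : R => Num.max 0 y ^+ 2) \o (fun y => (-1) * y + 2).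
    by apply/funext => y /=; rewrite mulN1r addrC.
  by apply: sdiff_comp; [exact: sdiff_sqr_pos|exact: lin].
have s2 : sdiff (U := R^o) (V := R^o) (fun y : R => Num.max 0 (y - 1) ^+ 2) s.
  have -> : (fun y : R => Num.max 0 (y - 1) ^+ 2) =
      (fun y : R => Num.max 0 y ^+ 2) \o (fun y => 1 * y - 1).
    by apply/funext => y /=; rewrite mul1r.
  by apply: sdiff_comp; [exact: sdiff_sqr_pos|exact: lin].
rewrite /plateau; apply: (sdiffZ (V := R^o)) => //.
apply: (@sdiff_comp _ R^o R^o R^o (fun y => y^-1)
  (fun s => Num.max 0 (2 - s) ^+ 2 + Num.max 0 (s - 1) ^+ 2)).
  by apply: sdiff_inv; rewrite gt_eqF// plateau_den_gt0.
exact: sdiffD.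
Qed.

Lemma sdiff_sqnorm n (x : 'rV[R]_n) : sdiff (V := R^o) (@sqnorm R n) x.
Proof.
rewrite /sqnorm.
have coord i : sdiff (V := R^o) (fun y : 'rV[R]_n => y 0 i) x.
  apply: sdiff_bounded_linear; split=> [a y z|]; first by rewrite !mxE.
  by exists 1 => // v; rewrite mul1r mx_coord_le.
elim: (index_enum _) => [|i s ih].
  rewrite (_ : (fun y => _) = (fun=> 0 : R^o)); first exact: sdiff_cst.
  by apply/funext => y; rewrite big_nil.
rewrite (_ : (fun y => _) = fun y : 'rV[R]_n =>
    y 0 i *: (y 0 i : R^o) + \sum_(j <- s) y 0 j ^+ 2); last first.
  by apply/funext => y; rewrite big_cons expr2.
by apply: sdiffD => //; exact: sdiffZ.
Qed.

Lemma sdiff_rinversion n (x : 'rV[R]_n) : x != 0 -> sdiff (@rinversion R n) x.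
Proof.
move=> x0; have -> : @rinversion R n = fun y => (sqnorm y)^-1 *: reflect0 y.
  by apply/funext => y; rewrite /rinversion sqr_enorm.
apply: sdiffZ.
  apply: (@sdiff_comp _ _ R^o R^o (fun y => y^-1) (@sqnorm R n)); last exact: sdiff_sqnorm.
  by apply: sdiff_inv; rewrite sqnorm_eq0.
apply: sdiff_bounded_linear; split=> [a y z|].
  by rewrite reflect0D reflect0Z.
exists 1 => // v; rewrite mul1r; apply: mx_norm_le => // i j.
by rewrite !mxE; case: ifP; rewrite ?normrN mx_coord_le.
Qed.

Lemma cutoff n : (0 < n)%N -> exists (phi : 'rV[R]_n -> R) (c L : R),
  [/\ 0 < c, 0 < L, (forall x, sdiff (V := R^o) phi x) & lip (V := R^o) L phi] /\
  [/\ (forall x, `|x| <= c -> phi x = 1), (forall x, 3 / 2 <= `|x| -> phi x = 0)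
    & forall x, 0 <= phi x <= 1].
Proof.
move=> n0; have nr : 0 < n%:R :> R by rewrite ltr0n.
(* The radius [3/2] works because its square is at least 2 and the Euclidean norm dominates the sup
   norm; [c = 1/n] works because the Euclidean norm is at most [n] times the sup norm. *)
pose phi := plateau \o @sqnorm R n.
have sphi x : sdiff (V := R^o) phi x.
  apply: (@sdiff_comp _ _ R^o R^o plateau (@sqnorm R n)); first exact: sdiff_plateau.
  exact: sdiff_sqnorm.
have phi0 x : 3 / 2 <= `|x| -> phi x = 0.
  move=> x2; apply: plateau0; rewrite -sqr_enorm.
  have := norm_le_enorm x; nra.
pose v : 'rV[R]_1 := 1%:M.
have v1 : `|v| = 1.
  apply/eqP; rewrite eq_le; apply/andP; split.
    by apply: mx_norm_le => // i j; rewrite (ord1 i) (ord1 j) mxE eqxx normr1.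
  by have := mx_coord_le v 0 0; rewrite mxE eqxx normr1.
have [L L0 phiL] : exists2 L : R, 0 < L & lip L (fun x => phi x *: v).
  apply: (lip_compact_support (r := 3 / 2) n0) => [x|x xr].
    by apply: sdiff_loclip; apply: sdiffZ => //; exact: sdiff_cst.
  by rewrite phi0 ?scale0r// ltW.
exists phi, (n%:R^-1), L; split; split => //.
- by rewrite invr_gt0.
- by move=> x y; have := phiL x y; rewrite -scalerBl normrZ v1 mulr1.
- move=> x xc; apply: plateau1; rewrite -sqr_enorm expr_le1 ?enorm_ge0//.
  apply: le_trans (enorm_le_norm x) _.
  by rewrite -ler_pdivlMl// mulr1.
- by move=> x; rewrite plateau_ge0 plateau_le1.
Qed.

End Cutoff.

(** * Extension of germs *)

Section Extension.
Context {R : realType} {n : nat} (eps : R).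
Hypothesis (n0 : (0 < n)%N) (e0 : 0 < eps).
Implicit Types (x y z : 'rV[R]_n) (h H : 'rV[R]_n -> 'rV[R]_n).

(** The compactly supported maps used to match a germ. The Lipschitz inverse serves in
    [generated_chart], to show that [q'] is locally Lipschitz. *)
Definition chain H : Prop :=
  [/\ forall x, sdiff H x, exists r, forall x, r <= `|x| -> H x = x,
      generated eps (ext H)
    & exists H', [/\ cancel H H', cancel H' H & exists2 C, 0 < C & lip C H']].

Lemma chain_comp h H : chain h -> chain H -> chain (h \o H).
Proof.
move=> [sh [r hr] gh [h' [hK h'K [C C0 hC]]]] [sH [r' Hr'] gH [H' [HK H'K [C' C'0 HC']]]].
split.
- by move=> x; exact: sdiff_comp.
- exists (Num.max r r') => x; rewrite ge_max => /andP[rx r'x] /=.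
  by rewrite Hr'// hr.
- by rewrite ext_comp; exact: generated_comp.
- exists (H' \o h'); split; [exact: (can_comp hK HK)|exact: (can_comp H'K h'K)|].
  exists (C' * C) => [|x y]; first exact: mulr_gt0.
  by rewrite -mulrA (le_trans (HC' _ _))// ler_pM2l.
Qed.

Lemma chain_id : chain id.
Proof.
split; [move=> x; exact: sdiff_id|by exists 0| |].
  by rewrite (_ : ext _ = id); [exact: generated_id|apply/funext => -[]].
by exists id; split => //; exists 1 => // x y; rewrite mul1r.
Qed.

Lemma chain_iter h N : chain h -> chain (iter N h).
Proof.
by move=> ch; elim: N => [|N ih]; [exact: chain_id|exact: (chain_comp ch ih)].
Qed.

Lemma near_id_chain : exists2 d : R, 0 < d & forall h, near_id d h ->
  (forall x, sdiff h x) -> (exists r, forall x, r <= `|x| -> h x = x) -> chain h.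
Proof.
have [d /andP[d0 d1] dP] := near_id_small (R := R) n0 e0.
exists d => // h hd sh hr; split => //; first exact/generated_small/dP.
have [h' [hK h'K hl]] := near_id_inv d0 d1 hd.1.
by exists h'; split => //; exists (1 - d)^-1; rewrite // invr_gt0 subr_gt0.
Qed.

(** The rescaled cutoff has slope [L / r], but [u] is at most [2 r k] on its support, so the
    resulting constant does not depend on [r]. *)
Lemma cutoff_lip (phi : 'rV[R]_n -> R) (L r k : R) (u : 'rV[R]_n -> 'rV[R]_n) :
  0 < L -> 0 < r -> 0 <= k ->
  lip (V := R^o) L phi -> (forall x, 3 / 2 <= `|x| -> phi x = 0) ->
  (forall x, 0 <= phi x <= 1) -> u 0 = 0 ->
  (forall y z, `|y| < 2 * r -> `|z| < 2 * r -> `|u y - u z| <= k * `|y - z|) ->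
  lip ((1 + 2 * L) * k) (fun x => phi (r^-1 *: x) *: u x).
Proof.
move=> L0 r0 k0 phiL phi0 phi01 u0 uk.
have phir y z : `|phi (r^-1 *: y) - phi (r^-1 *: z)| <= L / r * `|y - z|.
  apply: le_trans (phiL _ _) _.
  by rewrite -scalerBr normrZ gtr0_norm ?invr_gt0// mulrA.
have phir0 z : 2 * r <= `|z| -> phi (r^-1 *: z) = 0.
  move=> rz; apply: phi0; rewrite normrZ gtr0_norm ?invr_gt0//.
  by rewrite ler_pdivlMl//; lra.
have ub z : `|z| < 2 * r -> `|u z| <= 2 * r * k.
  move=> zr; have z0 : `|0 : 'rV[R]_n| < 2 * r by rewrite normr0 mulr_gt0.
  have := uk z 0 zr z0; rewrite u0 !subr0 => /le_trans; apply.
  by rewrite mulrC ler_wpM2r// ltW.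
have prod y z : `|z| < 2 * r ->
    `|(phi (r^-1 *: y) - phi (r^-1 *: z)) *: u z| <= 2 * L * k * `|y - z|.
  move=> zr; rewrite normrZ.
  apply: (@le_trans _ _ ((L / r * `|y - z|) * (2 * r * k))).
    by rewrite ler_pM// ub.
  by rewrite le_eqVlt; apply/orP; left; apply/eqP; field; rewrite gt_eqF.
have mixed y z : `|z| < 2 * r -> 2 * r <= `|y| ->
    `|phi (r^-1 *: y) *: u y - phi (r^-1 *: z) *: u z| <= (1 + 2 * L) * k * `|y - z|.
  move=> zr yr; have := prod y z zr; rewrite (phir0 y yr) sub0r scale0r sub0r scaleNr.
  have : 0 <= k * `|y - z| by rewrite mulr_ge0.
  lra.
move=> y z /=; have [yr|yr] := ltP `|y| (2 * r); have [zr|zr] := ltP `|z| (2 * r).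
- rewrite (_ : _ - _ = phi (r^-1 *: y) *: (u y - u z) +
    (phi (r^-1 *: y) - phi (r^-1 *: z)) *: u z); last first.
    by rewrite scalerBr scalerBl addrA subrK.
  have := prod y z zr; have := uk _ _ yr zr => h1 h2.
  apply: le_trans (ler_normD _ _) _.
  have : `|phi (r^-1 *: y) *: (u y - u z)| <= 1 * (k * `|y - z|).
    rewrite normrZ ler_pM//; have /andP[p0 p1] := phi01 (r^-1 *: y).
    by rewrite ger0_norm.
  lra.
- by rewrite distrC [`|y - _|]distrC; exact: mixed.
- exact: mixed.
- rewrite !phir0// !scale0r subrr normr0 !mulr_ge0//.
  by have : 0 < 2 * L; [rewrite mulr_gt0|lra].
Qed.

(** A zero strict derivative makes [u] Lipschitz near 0 with any prescribed constant [k]; cutting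
    [u] off at a small enough scale [t] leaves a map near the identity. *)
Lemma chain_tangent_id (u : 'rV[R]_n -> 'rV[R]_n) (r : R) : 0 < r ->
  (forall x, `|x| < r -> sdiff u x) -> u 0 = 0 ->
  strict_derivative u 0 (fun=> 0) ->
  exists2 H, chain H & \forall x \near (0 : 'rV[R]_n), H x = x + u x.
Proof.
move=> r0 us u0 ud; have [d d0 dP] := near_id_chain.
have [phi [c [L [[c0 L0 sphi phiL] [phi1 phi0 phi01]]]]] := cutoff (R := R) n0.
have L12 : 0 < 1 + 2 * L by rewrite addr_gt0// mulr_gt0.
pose k := d / (1 + 2 * L).
have k0 : 0 < k by rewrite divr_gt0.
have kE : (1 + 2 * L) * k = d by rewrite /k mulrC divfK// gt_eqF.
have [[A B] /= [/nearP_norm[d1 d10 dA] /nearP_norm[d2 d20 dB]] AB] := ud _ k0.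
pose t := Num.min r (Num.min d1 d2) / 2.
have t0 : 0 < t by rewrite divr_gt0// !lt_min r0 d10.
have tr : 2 * t <= r by rewrite /t mulrC divfK// ge_min lexx.
have t1 : 2 * t <= d1 by rewrite /t mulrC divfK// !ge_min lexx orbT.
have t2 : 2 * t <= d2 by rewrite /t mulrC divfK// !ge_min lexx !orbT.
have uk y z : `|y| < 2 * t -> `|z| < 2 * t -> `|u y - u z| <= k * `|y - z|.
  move=> yt zt; have := AB (y, z); rewrite /= subr0; apply; split.
    by apply: dA; rewrite subr0 (lt_le_trans yt).
  by apply: dB; rewrite subr0 (lt_le_trans zt).
pose w x := phi (t^-1 *: x) *: u x.
have far x : 3 / 2 * t <= `|x| -> w x = 0.
  move=> xt; rewrite /w phi0 ?scale0r// normrZ gtr0_norm ?invr_gt0//.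
  by rewrite ler_pdivlMl// mulrC.
exists (fun x => x + w x).
  apply: dP; first split.
  - move=> x y; rewrite ![_ + w _]addrC !addrK -kE.
    exact: (cutoff_lip L0 t0 (ltW k0)).
  - by rewrite add0r /w u0 scaler0 normr0 ltW.
  - move=> x; apply: sdiffD; first exact: sdiff_id.
    have [xt|xt] := ltP `|x| (2 * t).
      apply: sdiffZ; last by apply: us; lra.
      apply: (sdiff_comp (W := R^o) (u := phi) (g := fun y => t^-1 *: y)) => //.
      rewrite (_ : (fun y => _) = fun y : 'rV[R]_n => (fun=> t^-1) y *: y)//.
      by apply: sdiffZ; [exact: sdiff_cst|exact: sdiff_id].
    apply: (@sdiff_near _ _ _ _ (fun=> 0)); last exact: sdiff_cst.
    apply/nearP_norm; exists (t / 2) => [|y yx]; first by rewrite divr_gt0.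
    by apply: far; have := ler_normD (x - y) y; rewrite subrK distrC; lra.
  - by exists (3 / 2 * t) => x /far ->; rewrite addr0.
apply/nearP_norm; exists (c * t) => [|x]; first exact: mulr_gt0.
rewrite subr0 => xc; rewrite /w phi1 ?scale1r// normrZ gtr0_norm ?invr_gt0//.
by rewrite ler_pdivrMl// mulrC ltW.
Qed.

(** [A] is a product of matrices [M] close to 1, and each is cut off to
    [x + phi x *: x *m (M - 1)]. *)
Lemma chain_linear (A : 'M[R]_n) : 0 < \det A ->
  exists2 H, chain H & \forall x \near (0 : 'rV[R]_n), H x = x *m A.
Proof.
have [d d0 dP] := near_id_chain.
have [phi [c [L [[c0 L0 sphi phiL] [phi1 phi0 phi01]]]]] := cutoff (R := R) n0.
pose v x := phi x *: x.
have sv x : sdiff v x by apply: sdiffZ => //; exact: sdiff_id.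
have v0 x : 3 / 2 <= `|x| -> v x = 0 by move=> x2; rewrite /v phi0// scale0r.
have [C C0 vC] := lip_compact_support n0 (fun x => sdiff_loclip (sv x))
  (fun x xr => v0 x (ltW xr)).
have nr : 0 < n%:R :> R by rewrite ltr0n.
pose k := d / (n%:R * C).
have k0 : 0 < k by rewrite divr_gt0// mulr_gt0.
move/(mx_generated_pos_det k0) => gA.
(* Fixing 0 is carried along, so that the germs at 0 compose. *)
suff [H cH [_ nH]] : exists2 H, chain H &
    H 0 = 0 /\ \forall x \near (0 : 'rV[R]_n), H x = x *m A by exists H.
elim: gA => [|M B Mk _ [H cH [H0 nH]]].
  exists id; first exact: chain_id.
  by split => //; near=> x; rewrite mulmx1.
pose h x := x + v x *m (M - 1%:M).
exists (H \o h).
  apply: chain_comp => //; apply: dP; first split.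
  - move=> x y; rewrite /h ![_ + _ *m _]addrC !addrK -mulmxBl.
    apply: le_trans (mulmx_norm_le _ _) _.
    apply: (@le_trans _ _ (n%:R * (C * `|x - y|) * k)).
      by rewrite ler_pM// ?mulr_ge0// ler_pM2l.
    rewrite le_eqVlt; apply/orP; left; apply/eqP; rewrite /k; field.
    by rewrite !gt_eqF.
  - by rewrite /h add0r /v scaler0 mul0mx normr0 ltW.
  - move=> x; apply: sdiffD; first exact: sdiff_id.
    apply: (sdiff_comp (u := fun y => y *m (M - 1%:M)) (g := v)) => //.
    exact/sdiff_bounded_linear/bounded_linear_mulmx.
  - by exists (3 / 2) => x /v0 x0; rewrite /h x0 mul0mx addr0.
have hE x : `|x| <= c -> h x = x *m M.
  by move=> xc; rewrite /h /v phi1// scale1r mulmxBr mulmx1 addrCA subrr addr0.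
have h0 : h 0 = 0 by rewrite hE ?mul0mx// normr0 ltW.
split; first by rewrite /= h0.
have hc : {for (0 : 'rV[R]_n), continuous h}.
  apply: sdiff_continuous; apply: sdiffD; first exact: sdiff_id.
  apply: (sdiff_comp (u := fun y => y *m (M - 1%:M)) (g := v)) => //.
  exact/sdiff_bounded_linear/bounded_linear_mulmx.
have /nearP_norm[r1 r10 r1P] := nH.
have [r2 r20 r2P] := continuous_norm hc r10.
apply/nearP_norm; exists (Num.min c r2); first by rewrite lt_min c0.
move=> x; rewrite lt_min subr0 => /andP[xc xr].
have := r2P x; rewrite h0 !subr0 => /(_ xr) hx.
by rewrite /= r1P ?subr0// hE ?mulmxA// ltW.
Unshelve. all: by end_near. Qed.

Lemma chain_translation (b : 'rV[R]_n) :
  exists2 H, chain H & forall x, `|x| < 1 -> H x = x + b.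
Proof.
have [d d0 dP] := near_id_chain.
have [phi [c [L [[c0 L0 sphi phiL] [phi1 phi0 phi01]]]]] := cutoff (R := R) n0.
(* The region where the cutoff equals 1 has radius [c r >= 1 + |b|], so it contains the whole track
   of the unit ball during the [N] steps. *)
pose r := Num.max 1 ((1 + `|b|) / c).
have r1 : 1 <= r by rewrite le_max lexx.
have r0 : 0 < r by apply: lt_le_trans r1.
have rc : 1 + `|b| <= c * r by rewrite mulrC -ler_pdivrMr// /r le_max lexx orbT.
have [N N0 NP] := exists_nat_gt ((1 + L) * `|b|) d0.
have Nr : 0 < N%:R :> R by rewrite ltr0n.
pose v := N%:R^-1 *: b.
have vd : (1 + L) * `|v| <= d.
  by rewrite /v normrZ gtr0_norm ?invr_gt0// mulrCA ler_pdivrMl.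
have Lv : 0 <= L * `|v| by rewrite mulr_ge0// ltW.
pose h x := x + phi (r^-1 *: x) *: v.
have ch : chain h.
  apply: dP; first split.
  - move=> x y; rewrite /h ![_ + _ *: v]addrC !addrK -scalerBl normrZ.
    apply: (@le_trans _ _ (L * `|r^-1 *: x - r^-1 *: y| * `|v|)).
      by rewrite ler_wpM2r//; exact: phiL.
    rewrite -scalerBr normrZ gtr0_norm ?invr_gt0//.
    have : r^-1 * `|x - y| <= 1 * `|x - y| by rewrite ler_wpM2r// invf_le1.
    move=> h1; have : L * (r^-1 * `|x - y|) * `|v| <= L * (1 * `|x - y|) * `|v|.
      by rewrite ler_wpM2r// ler_pM2l.
    have : 0 <= `|v| by []. have : 0 <= `|x - y| by [].
    nra.
  - rewrite /h add0r scaler0 phi1; last by rewrite normr0 ltW.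
    rewrite scale1r; lra.
  - move=> x; apply: sdiffD; first exact: sdiff_id.
    apply: sdiffZ; last exact: sdiff_cst.
    apply: (sdiff_comp (W := R^o) (u := phi) (g := fun y => r^-1 *: y)) => //.
    rewrite (_ : (fun y => _) = fun y : 'rV[R]_n => (fun=> r^-1) y *: y)//.
    by apply: sdiffZ; [exact: sdiff_cst|exact: sdiff_id].
  - exists (3 / 2 * r) => x xr; rewrite /h phi0 ?scale0r ?addr0//.
    by rewrite normrZ gtr0_norm ?invr_gt0// ler_pdivlMl// mulrC.
exists (iter N h); first exact: chain_iter.
move=> x x1; have E k : (k <= N)%N -> iter k h x = x + (k%:R / N%:R) *: b.
  elim: k => [|k ih] kN; first by rewrite mul0r scale0r addr0.
  rewrite iterS ih ?(ltnW kN)// /h phi1.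
    by rewrite scale1r /v -addrA -scalerDl -natr1 mulrDl mul1r.
  rewrite normrZ gtr0_norm ?invr_gt0// ler_pdivrMl// [leRHS]mulrC; apply: le_trans rc.
  rewrite (le_trans (ler_normD _ _))// lerD//; first exact: ltW.
  rewrite normrZ ger0_norm ?divr_ge0// ler_piMl// ler_pdivrMr// mul1r ler_nat.
  exact: ltnW.
by rewrite E// divff ?scale1r// gt_eqF.
Qed.

(** Removing [f 0] and the linear part [A] from [f] leaves a germ tangent to the identity; the three
    pieces are extended separately. *)
Lemma chain_extension (f : 'rV[R]_n -> 'rV[R]_n) (A : 'M[R]_n) (r : R) :
  0 < r -> (forall x, `|x| < r -> sdiff f x) ->
  strict_derivative f 0 (fun x => x *m A) -> 0 < \det A ->
  exists2 H, chain H & \forall x \near (0 : 'rV[R]_n), H x = f x.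
Proof.
move=> r0 sf fA A0.
have [T cT TE] := chain_translation (f 0).
have [M cM ME] := chain_linear A0.
have uA : A \in unitmx by rewrite unitmxE unitfE gt_eqF.
pose u x := (f x - f 0) *m invmx A - x.
have su x : `|x| < r -> sdiff u x.
  move=> xr; apply: sdiffD; last exact: sdiff_opp.
  apply: (sdiff_comp (u := fun y => y *m invmx A) (g := fun x => f x - f 0)).
    exact/sdiff_bounded_linear/bounded_linear_mulmx.
  by apply: sdiffD; [exact: sf|exact: sdiff_cst].
have u0 : u 0 = 0 by rewrite /u subrr mul0mx subr0.
have ud : strict_derivative u 0 (fun=> 0).
  move=> e e1; pose k := n%:R * `|invmx A| + 1.
  have k0 : 0 < k by rewrite ltr_wpDl// mulr_ge0.
  have := fA (e / k); rewrite divr_gt0// => /(_ isT); apply: near_pairS => y z h.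
  rewrite subr0 (_ : u y - u z = (f y - f z - (y - z) *m A) *m invmx A); last first.
    rewrite /u [in RHS]mulmxBl mulmxK//.
    have -> : f y - f z = (f y - f 0) - (f z - f 0) by rewrite opprB addrA subrK.
    by rewrite [in RHS]mulmxBl !opprB !addrA [LHS](AC 4 (1*4*3*2)).
  apply: le_trans (mulmx_norm_le _ _) _; rewrite mulrAC.
  apply: (@le_trans _ _ (k * (e / k * `|y - z|))).
    by rewrite ler_pM// ?mulr_ge0// lerDl.
  by rewrite mulrA [k * _]mulrC divfK// gt_eqF.
have [h ch hE] := chain_tangent_id r0 su u0 ud.
exists (T \o (M \o h)); first by apply: chain_comp => //; exact: chain_comp.
have h0 : h 0 = 0 by rewrite (nbhs_singleton hE) u0 addr0.
have [sh _ _ _] := ch.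
have /nearP_norm[r1 r10 r1P] := hE; have /nearP_norm[r2 r20 r2P] := ME.
have [r3 r30 r3P] := continuous_norm (sdiff_continuous (sh 0)) r20.
have f0 : `|0 : 'rV[R]_n| < r by rewrite normr0.
have [r4 r40 r4P] := continuous_norm (sdiff_continuous (sf 0 f0)) ltr01.
apply/nearP_norm; exists (Num.min (Num.min r1 r3) r4).
  by rewrite !lt_min r10 r30.
move=> x; rewrite !lt_min => /andP[/andP[x1 x3] x4] /=.
rewrite r2P; last by have := r3P _ x3; rewrite h0.
rewrite r1P// /u addrC subrK -mulmxA mulVmx// mulmx1.
by rewrite TE ?subrK//; exact: r4P.
Qed.

End Extension.

(** * The factorization *)

Section Main.
Context {R : realType} {n : nat}.
Local Notation S := (sphere R n).
Implicit Types (x : 'rV[R]_n) (f g : S -> S).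

Definition strictly_smooth f : Prop := forall (i j : bool) x,
  chart_dom j (f (chart_inv i x)) -> sdiff (local_rep f i j) x.

Lemma C1_map_strictly_smooth f : C1_map f -> strictly_smooth f.
Proof.
move=> [_ fC] i j x /fC /C1_at_strict_derivative h.
by exists (fun v => v *m 'J (local_rep f i j) x) => //; exact: bounded_linear_mulmx.
Qed.

Lemma local_rep_sinv_left f i j : local_rep (sinv \o f) i j = local_rep f i (~~ j).
Proof. by apply/funext => x; rewrite /local_rep /= chart_sinv. Qed.

Lemma local_rep_sinv_right f i j : local_rep (f \o sinv) i j = local_rep f (~~ i) j.
Proof. by apply/funext => x; rewrite /local_rep /= sinv_chart_inv. Qed.

Lemma strictly_smooth_sinv_left f : strictly_smooth f -> strictly_smooth (sinv \o f).
Proof.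
by move=> sf i j x /chart_dom_sinv fx; rewrite local_rep_sinv_left; exact: sf.
Qed.

Lemma strictly_smooth_sinv_right f : strictly_smooth f -> strictly_smooth (f \o sinv).
Proof.
move=> sf i j x /=; rewrite sinv_chart_inv local_rep_sinv_right; exact: sf.
Qed.

Lemma chart_inv_near b x (s : S) : chart_inv b x <> s ->
  exists2 d : R, 0 < d & forall y, `|y - x| < d -> chart_inv b y <> s.
Proof.
move=> xs; have [sp|sp] := pselect (s = pole R n b).
  by exists 1 => // y _; rewrite sp; exact: chart_inv_dom.
have sE := chartK sp; exists `|chart b s - x|.
  by rewrite normr_gt0 subr_eq0; apply/eqP => h; apply: xs; rewrite -h.
by move=> y + ys; rewrite -ys chart_invK ltxx.
Qed.

(** [sinv] sends a small ball around 0 beyond radius [r]. The factor [n^2] comes from two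
    comparisons of the sup norm with the Euclidean norm. *)
Lemma sinv_ext_fixed (K : 'rV[R]_n -> 'rV[R]_n) (r : R) :
  (forall x, r <= `|x| -> K x = x) ->
  exists2 d : R, 0 < d & forall x, `|x| < d ->
    ext K (sinv (Some x)) = sinv (Some x).
Proof.
move=> Kr; pose M := Num.max r 1 * n%:R ^+ 2 + 1.
have r1 : 1 <= Num.max r 1 by rewrite le_max lexx orbT.
have M0 : 0 < M by rewrite ltr_wpDl// mulr_ge0 ?sqr_ge0//; lra.
exists M^-1 => [|x xM]; first by rewrite invr_gt0.
have [->|x0] := eqVneq x 0; first by rewrite sinv0.
rewrite sinv_neq0//=; congr Some; apply: Kr.
apply: (@le_trans _ _ (Num.max r 1)); first by rewrite le_max lexx.
have x0' : 0 < `|x| by rewrite normr_gt0.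
have ex0 : 0 < enorm x by apply: lt_le_trans (norm_le_enorm x).
have eE : enorm (rinversion x) * enorm x = 1.
  rewrite /enorm sqnorm_rinversion sqrtrV ?sqnorm_ge0// mulVf//.
  by rewrite gt_eqF.
have h1 := enorm_le_norm (rinversion x); have h2 := enorm_le_norm x.
have h3 : 1 <= (n%:R * `|rinversion x|) * (n%:R * `|x|).
  by rewrite -[leLHS]eE ler_pM// ?enorm_ge0.
have h4 : M * `|x| < 1 by rewrite -ltr_pdivlMl// mulr1.
have h5 : n%:R * `|rinversion x| * (n%:R * `|x|) = n%:R ^+ 2 * `|rinversion x| * `|x| by ring.
have h6 : M < n%:R ^+ 2 * `|rinversion x|.
  by rewrite -(ltr_pM2r x0') -h5; exact: lt_le_trans h4 h3.
have n2 : 0 <= n%:R ^+ 2 :> R by exact: sqr_ge0.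
rewrite leNgt; apply/negP => rlt.
have : n%:R ^+ 2 * `|rinversion x| <= n%:R ^+ 2 * Num.max r 1.
  by rewrite ler_wpM2l// ltW.
rewrite /M in h6; lra.
Qed.

Lemma generated_chart eps f g (A : 'M[R]_n) : (0 < n)%N -> 0 < eps ->
  cancel f g -> cancel g f -> strictly_smooth f -> strictly_smooth g ->
  f (Some 0) <> None ->
  strict_derivative (local_rep f true true) 0 (fun x => x *m A) -> 0 < \det A ->
  generated eps f.
Proof.
move=> n0 e0 fK gK sf sg f0 fA A0.
have g0 : chart_inv true (0 : 'rV[R]_n) <> g None by move=> h; apply: f0; rewrite [Some 0]h gK.
have [rho rho0 rhoP] := chart_inv_near g0.
have fin x : `|x| < rho -> f (Some x) <> None.
  by move=> xr fx; apply: (rhoP x); rewrite ?subr0// -fx fK.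
have [H [sH [r Hr] gH [H' [HK H'K [C C0 H'C]]]] /nearP_norm[d d0 HE]] :=
  chain_extension n0 e0 rho0 (fun x xr => sf true true x (fin x xr)) fA A0.
have fH x : `|x| < Num.min rho d -> f (Some x) = Some (H x).
  rewrite lt_min => /andP[xr xd]; rewrite HE ?subr0// /local_rep /=.
  by have := fin x xr; case: (f (Some x)).
have f0E : f (Some 0) = Some (H 0) by apply: fH; rewrite normr0 lt_min rho0.
have H'r x : r <= `|x| -> H' x = x by move=> xr; rewrite -[in LHS](Hr _ xr) HK.
(* Since [H] agrees with [f] near 0, [g H] is the identity there, so [Q] fixes a neighbourhood of
   infinity. *)
pose Q : S -> S := sinv \o g \o ext H \o sinv.
pose Q' : S -> S := sinv \o ext H' \o f \o sinv.
have QK : cancel Q Q'.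
  by move=> p; rewrite /Q /Q' /= sinvK gK (ext_can HK) sinvK.
have Q'K : cancel Q' Q.
  by move=> p; rewrite /Q /Q' /= sinvK (ext_can H'K) fK sinvK.
have Qinf : Q None = None.
  by rewrite /Q /comp sinv_inf /= -f0E fK sinv0.
have Q'inf : Q' None = None by rewrite -[in LHS]Qinf QK.
pose q x := chart true (Q (Some x)); pose q' x := chart true (Q' (Some x)).
have Qq x : Q (Some x) = Some (q x).
  rewrite /q; case E : (Q (Some x)) => [//|].
  by have := QK (Some x); rewrite E Q'inf.
have Q'q x : Q' (Some x) = Some (q' x).
  rewrite /q'; case E : (Q' (Some x)) => [//|].
  by have := Q'K (Some x); rewrite E Qinf.
have QE : Q = ext q by apply/funext => -[x|]; rewrite ?Qinf// Qq.
have qK : cancel q q' by move=> x; apply: Some_inj; rewrite -Q'q -Qq QK.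
have q'K : cancel q' q by move=> x; apply: Some_inj; rewrite -Qq -Q'q Q'K.
have [c c0 cP] := sinv_ext_fixed Hr; have [c' c'0 c'P] := sinv_ext_fixed H'r.
have chQ (p : S) : chart true (sinv p) = chart false p by exact: (chart_sinv true).
(* At 0, [H] has become the identity, being so near infinity, and [q] is [g] read in the chart at
   infinity; elsewhere [q] is a composite of [rinversion], [H] and a representative of [g]. *)
have sq x : sdiff q x.
  have [->|x0] := eqVneq x 0.
    apply: (@sdiff_near _ _ _ _ (local_rep g false false)).
      apply/nearP_norm; exists c => // y; rewrite subr0 => yc.
      by rewrite /q /Q /= cP.
    apply: sg; rewrite /chart_inv eqxx => /= h.
    by have := f0E; rewrite -[Some 0]/(pole R n false) -h gK.
  apply: (@sdiff_near _ _ _ _ (local_rep g true false \o (H \o @rinversion R n))).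
    apply/nearP_norm; exists `|x| => [|y yx]; first by rewrite normr_gt0.
    have y0 : y != 0 by apply: contraTneq yx => ->; rewrite sub0r normrN ltxx.
    by rewrite /q /Q /= sinv_neq0//= chQ.
  apply: sdiff_comp.
    apply: sg => /= h; have : ext H (Some (rinversion x)) = ext H (Some 0).
      by rewrite /= -f0E -[Some 0 in RHS]/(pole R n false) -h gK.
    move=> /(can_inj (ext_can HK)) [] /eqP.
    by rewrite (negbTE (rinversion_neq0 x0)).
  by apply: sdiff_comp => //; exact: sdiff_rinversion.
have lq' x : loclip q' x.
  (* If [f] sends the point to infinity then [H'] is the identity near the image, and [q'] is a
     representative of [f]; otherwise [H'] acts in the finite chart. *)
  have [fx|fx] := pselect (f (chart_inv false x) = None).
    have sx : sdiff (local_rep f false false) x by apply: sf; rewrite fx.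
    have lx0 : local_rep f false false x = 0 by rewrite /local_rep fx.
    have [d1 d10 d1P] := continuous_norm (sdiff_continuous sx) c'0.
    have gx : chart_inv false x <> g (Some 0) by move=> h; move: fx; rewrite h gK.
    have [d2 d20 d2P] := chart_inv_near gx.
    apply: (@loclip_near _ _ _ _ (local_rep f false false)); last exact: sdiff_loclip.
    apply/nearP_norm; exists (Num.min d1 d2); first by rewrite lt_min d10.
    move=> y; rewrite lt_min => /andP[y1 y2].
    have fy : chart_dom false (f (chart_inv false y)).
      by move=> h; apply: (d2P y y2); rewrite -[LHS]fK h.
    have ly := d1P _ y1; rewrite lx0 subr0 in ly.
    rewrite /q' /Q' /= chQ -(chartK fy) -[chart_inv false (chart _ _)]/(sinv (Some _)).
    rewrite c'P// /sinv chart_invK /local_rep.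
    by [].
  have sx : sdiff (local_rep f false true) x by exact: sf.
  have gx : chart_inv false x <> g None by move=> h; apply: fx; rewrite h gK.
  have [d1 d10 d1P] := chart_inv_near gx.
  have fy y : `|y - x| < d1 -> f (chart_inv false y) = Some (local_rep f false true y).
    move=> yx; rewrite /local_rep; case E : (f (chart_inv false y)) => [//|].
    by have := d1P _ yx; rewrite -E fK.
  apply: (@loclip_near _ _ _ _ (@rinversion R n \o (H' \o local_rep f false true))).
    apply/nearP_norm; exists d1 => // y yx.
    by rewrite /q' /Q' /= chQ -[sinv (Some y)]/(chart_inv false y) fy.
  apply: loclip_comp.
    apply/sdiff_loclip/sdiff_rinversion; apply/eqP => h.
    have := Q'q x; rewrite /Q' /= /sinv fy ?subrr ?normr0//=.
    by rewrite /= in h; rewrite h /chart_inv eqxx.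
  apply: loclip_comp; last exact: sdiff_loclip.
  exact: lip_loclip C0 H'C.
(* Beyond this radius the inversion lands within [min rho d] of 0, where [f] and [H] agree. *)
have qfar x : Num.max 1 (Num.min rho d)^-1 < `|x| -> q x = x.
  rewrite gt_max => /andP[x1 xd].
  have m0 : 0 < Num.min rho d by rewrite lt_min rho0.
  have x0 : x != 0 by rewrite -normr_gt0; lra.
  apply: Some_inj; rewrite -Qq /Q /= sinv_neq0//= -fH ?fK -?sinv_neq0 ?sinvK//.
  apply: le_lt_trans (norm_le_enorm _) _.
  rewrite /enorm sqnorm_rinversion sqrtrV ?sqnorm_ge0// -/(enorm x).
  have ex := norm_le_enorm x; rewrite -[ltRHS]invrK ltf_pV2 ?posrE ?invr_gt0//; lra.
have gQ : generated eps Q.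
  by rewrite QE; exact: (generated_compact_support n0 e0 qK q'K sq lq' qfar).
have gX : generated eps (g \o ext H).
  have := generated_sinv_conj e0 gQ.
  rewrite (_ : _ \o _ = g \o ext H)//.
  by apply/funext => p; rewrite /Q /= !sinvK.
have gX' : generated eps (ext H' \o f).
  apply: (generated_inverse e0 _ _ gX).
    by move=> p /=; rewrite gK (ext_can HK).
  by move=> p /=; rewrite (ext_can H'K) fK.
rewrite (_ : f = ext H \o (ext H' \o f)); first exact: generated_comp.
by apply/funext => p /=; rewrite (ext_can H'K).
Qed.

Lemma generated_C1_diffeomorphism eps f : (0 < n)%N -> 0 < eps ->
  C1_diffeomorphism f -> orientation_preserving f -> generated eps f.
Proof.
move=> n0 e0 [fC [g [fK gK gC]]] fo.
have sf := C1_map_strictly_smooth fC; have sg := C1_map_strictly_smooth gC.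
have [f0|f0] := pselect (f (Some 0) = None); last first.
  have f0' : chart_dom true (f (chart_inv true (0 : 'rV[R]_n))) by [].
  apply: (@generated_chart _ _ g ('J (local_rep f true true) 0)) => //.
    by apply: C1_at_strict_derivative; exact: fC.2.
  exact: fo.
have f0' : chart_dom false (f (chart_inv true (0 : 'rV[R]_n))) by rewrite /= f0.
(* When [f] sends 0 to infinity, [sinv \o f] does not, and its finite representative at 0 is the one
   of [f] in the chart at infinity, so the Jacobian keeps its sign. *)
apply: (@generated_cancel_left _ _ _ sinv _ (sinv \o f)) => //.
  exact: generated_sinv.
apply: (@generated_chart _ _ (g \o sinv) ('J (local_rep f true false) 0)) => //.
- by move=> p /=; rewrite sinvK fK.
- by move=> p /=; rewrite gK sinvK.
- exact: strictly_smooth_sinv_left.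
- exact: strictly_smooth_sinv_right.
- by rewrite /= f0 sinv_inf.
- by rewrite local_rep_sinv_left; apply: C1_at_strict_derivative; exact: fC.2.
- exact: fo.
Qed.

End Main.

Theorem theorem1p4 (R : realType) (n : nat) (hn : (1 <= n)%N)
    (f : sphere R n -> sphere R n)
    (hf : C1_diffeomorphism f) (hor : orientation_preserving f)
    (eps : R) (heps : 0 < eps) :
  exists (m : nat) (g : 'I_m -> sphere R n -> sphere R n),
    [/\ (1 <= m)%N, f = composite g
      & forall k : 'I_m,
          [/\ homeomorphism (g k), bi_lipschitz (1 + eps) (g k)
            & forall x : sphere R n, chi (g k x) x < eps]].
Proof.
exact: (generated_composite heps (generated_C1_diffeomorphism hn heps hf hor)).
Qed.
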